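(* Let $\mathcal A$ be a unital complex $*$-algebra and let $(\Omega^1_{\mathrm d}(\mathcal A),\dagger,\langle\cdot|\cdot\rangle,\sigma^{\mathrm{can}})$ be a centred Hermitian differential calculus over $\mathcal A$. Write $\Omega=\Omega^1_{\mathrm d}(\mathcal A)$ and define the bimodule projections $P=\Psi\otimes 1,\ Q=1\otimes\Psi: T^3_{\mathrm d}(\mathcal A)\to T^3_{\mathrm d}(\mathcal A)$. Then there exists a unique Hermitian, torsion-free $\sigma^{\mathrm{can}}$-$\dagger$-bimodule connection $\overrightarrow{\nabla}^{G}$ on $\Omega$. Moreover, for any finite set of pairs $\{(\omega_i,\eta_i)\}$ of central elements $\omega_i,\eta_i\in\mathcal Z(\Omega)$ such that $\{(\omega_i,\eta_i)\}=\{(\omega_i^\dagger,\eta_i^\dagger)\}$ as sets and $$\omega=\sum_i\omega_i\langle\eta_i|\omega\rangle=\sum_i\eta_i\langle\omega_i|\omega\rangle\quad\text{for all }\omega\in\Omega,$$ the connection $\overrightarrow{\nabla}^{G}$ is given by the formula $$\overrightarrow{\nabla}^{G}(\omega)=\frac12\Big(\sum_i\omega_i\otimes\mathrm d\langle\eta_i|\omega\rangle+\eta_i\otimes\mathrm d\langle\omega_i|\omega\rangle\Big)-\overrightarrow{\alpha}\big((1+4PQ)W\big)(\omega),\qquad \omega\in\Omega,$$ where $W=\frac12\sum_i\big(\mathrm d_\Psi\omega_i\otimes\eta_i^\dagger+\mathrm d_\Psi\eta_i\otimes\omega_i^\dagger\big)\in T^3_{\mathrm d}(\mathcal A)$.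
   Context: Throughout $\mathcal A$ is a unital complex $*$-algebra. A $\dagger$-bimodule is an $\mathcal A$-bimodule $\mathcal X$ with an antilinear involution $\dagger$ satisfying $(axb)^\dagger=b^*x^\dagger a^*$. A Hermitian first-order differential structure over $\mathcal A$ consists of a $\dagger$-bimodule $\Omega=\Omega^1_{\mathrm d}(\mathcal A)$, a $\mathbb C$-linear derivation $\mathrm d:\mathcal A\to\Omega$ with $\mathrm d(a^* )=-\mathrm d(a)^\dagger$, such that every element of $\Omega$ is a finite sum $\sum a_i\,\mathrm d b_i$, $\Omega$ is finitely generated projective as an $\mathcal A$-module, together with a biadditive map $\langle\cdot|\cdot\rangle=\langle\cdot|\cdot\rangle_{\mathcal A}:\Omega\times\Omega\to\mathcal A$ with: (1) $\langle\omega|\eta a\rangle=\langle\omega|\eta\rangle a$; (2) $\langle\omega|\eta\rangle^*=\langle\eta|\omega\rangle$; (3) $\langle a\omega|\eta\rangle=\langle\omega|a^*\eta\rangle$; (4) strong non-degeneracy: $\omega\mapsto(\eta\mapsto\langle\omega^\dagger|\eta\rangle)$ is an isomorphism of left $\mathcal A$-modules from $\Omega$ onto the right-$\mathcal A$-linear maps $\Omega\to\mathcal A$. Put $T^k_{\mathrm d}(\mathcal A)=\Omega^{\otimes_{\mathcal A}k}$, a $\dagger$-bimodule via $(\omega_1\otimes\cdots\otimes\omega_k)^\dagger=\omega_k^\dagger\otimes\cdots\otimes\omega_1^\dagger$. The centre of a bimodule $\mathcal Y$ is $\mathcal Z(\mathcal Y)=\{y: ay=ya\ \forall a\in\mathcal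 A\}$, and $\mathcal Y$ is centred if $\mathcal Z(\mathcal Y)$ generates $\mathcal Y$ as a bimodule. If $\Omega$ is centred there is a unique invertible bimodule map $\sigma^{\mathrm{can}}:T^2_{\mathrm d}(\mathcal A)\to T^2_{\mathrm d}(\mathcal A)$ with $(\sigma^{\mathrm{can}})^{-1}\circ\dagger=\dagger\circ\sigma^{\mathrm{can}}$ and $\sigma^{\mathrm{can}}(\omega\otimes\eta)=\eta\otimes\omega$ whenever $\omega$ or $\eta$ is central; it is an involution. Put $\Psi=\frac12(1+\sigma^{\mathrm{can}})$. The bilinear quantum metric is $g:T^2_{\mathrm d}(\mathcal A)\to\mathcal A$, $g(\omega\otimes\eta)=-\langle\omega^\dagger|\eta\rangle$. The junk two-tensors are $JT^2_{\mathrm d}=\{\sum\mathrm d a_i\otimes\mathrm d b_i:\ \sum a_i\,\mathrm d b_i=0\}$ (finite sums). A centred Hermitian differential calculus is a Hermitian first-order differential structure such that $\Omega$ is centred, $g\circ\sigma^{\mathrm{can}}=g$, and $JT^2_{\mathrm d}\subset\operatorname{Im}\Psi$. Its exterior derivative is the well-defined map $\mathrm d_\Psi:\Omega\to T^2_{\mathrm d}(\mathcal A)$, $\mathrm d_\Psi(\sum a_i\,\mathrm d b_i)=(1-\Psi)(\sum\mathrm d a_i\otimes\mathrm d b_i)$. A right connection on $\Omega$ is a $\mathbb C$-linear map $\overrightarrow\nabla:\Omega\to T^2_{\mathrm d}(\mathcal A)$ with $\overrightarrow\nabla(\omega a)=\overrightarrow\nabla(\omega)a+\omega\otimes\mathrm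 d a$. It is torsion-free if $(1-\Psi)\circ\overrightarrow\nabla+\mathrm d_\Psi=0$. It is Hermitian if $-\langle\overrightarrow\nabla\omega|\eta\rangle_{\Omega}+\langle\omega|\overrightarrow\nabla\eta\rangle_{\Omega}=\mathrm d\langle\omega|\eta\rangle$ for all $\omega,\eta$, where $\langle\omega|\eta\otimes\rho\rangle_\Omega:=\langle\omega|\eta\rangle\rho$ and $\langle\eta\otimes\rho|\omega\rangle_\Omega:=\rho^\dagger\langle\eta|\omega\rangle$. It is a $\sigma^{\mathrm{can}}$-$\dagger$-bimodule connection if $\sigma^{\mathrm{can}}\circ\overrightarrow\nabla=-\dagger\circ\overrightarrow\nabla\circ\dagger$. The map $\overrightarrow\alpha$ sends $T^3_{\mathrm d}(\mathcal A)$ to the right-$\mathcal A$-linear maps $\Omega\to T^2_{\mathrm d}(\mathcal A)$ by $\overrightarrow\alpha(\eta\otimes\rho\otimes\tau)(\omega)=\eta\otimes\rho\,\langle\tau^\dagger|\omega\rangle$. *)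

(* Defs.v *)
From HB Require Import structures.
From mathcomp Require Import all_boot all_order all_algebra finmap.
From mathcomp Require Import boolp reals complex.

Set Implicit Arguments.
Unset Strict Implicit.
Unset Printing Implicit Defensive.

Import GRing.Theory Num.Theory.
Local Open Scope ring_scope.
Local Open Scope quotient_scope.

(* The base field is the field R[i] of complex numbers over a realType R.     *)
(* MathComp's algType excludes the zero ring, and the hierarchy has no place  *)
(* for a join of pzRingType and lmodType below it; hence the scalar           *)
(* multiplication `k ∙ a' of a complex algebra is given here explicitly.      *)

HB.mixin Record isStarAlgebra (R : realType) A of GRing.PzRing A := {
  cmul : R[i] -> A -> A ;
  cmulDl : forall (k l : R[i]) (a : A), cmul (k + l) a = cmul k a + cmul l a ;
  cmulDr : forall (k : R[i]) (a b : A), cmul k (a + b) = cmul k a + cmul k b ;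
  cmulA : forall (k l : R[i]) (a : A), cmul (k * l) a = cmul k (cmul l a) ;
  cmul1 : forall a : A, cmul 1 a = a ;
  cmul_mull : forall (k : R[i]) (a b : A), cmul k (a * b) = cmul k a * b ;
  cmul_mulr : forall (k : R[i]) (a b : A), cmul k (a * b) = a * cmul k b ;
  star : A -> A ;
  starD : forall a b : A, star (a + b) = star a + star b ;
  starZ : forall (k : R[i]) (a : A), star (cmul k a) = cmul k^* (star a) ;
  starM : forall a b : A, star (a * b) = star b * star a ;
  starK : involutive star
}.

#[short(type="starAlgType")]
HB.structure Definition StarAlgebra (R : realType) :=
  { A of isStarAlgebra R A & GRing.PzRing A }.

Notation "k ∙ a" := (cmul k a) (at level 40) : ring_scope.

(* The left action is the one of lmodType A.  The complex scalar              *)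
(* multiplication of a bimodule is (k ∙ 1) *: x, and it is central.           *)

HB.mixin Record isBimodule (R : realType) (A : starAlgType R) X
    of GRing.Lmodule A X := {
  ract : X -> A -> X ;
  ractDl : forall (x y : X) (a : A), ract (x + y) a = ract x a + ract y a ;
  ractDr : forall (x : X) (a b : A), ract x (a + b) = ract x a + ract x b ;
  ractA : forall (x : X) (a b : A), ract x (a * b) = ract (ract x a) b ;
  ract1 : forall x : X, ract x 1 = x ;
  lractA : forall (a : A) (x : X) (b : A), ract (a *: x) b = a *: ract x b ;
  ract_scalar : forall (k : R[i]) (x : X), ract x (k ∙ 1) = (k ∙ 1) *: x
}.

#[short(type="bimodType")]
HB.structure Definition Bimodule (R : realType) (A : starAlgType R) :=
  { X of isBimodule R A X & GRing.Lmodule A X }.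

Notation "x ⋅ a" := (ract x a) (at level 40, left associativity) : ring_scope.

Definition cscale (R : realType) (A : starAlgType R) (X : lmodType A)
  (k : R[i]) (x : X) : X := (k ∙ 1) *: x.

HB.mixin Record isDaggerBimodule (R : realType) (A : starAlgType R) X
    of Bimodule R A X := {
  dag : X -> X ;
  dagD : forall x y : X, dag (x + y) = dag x + dag y ;
  dagZ : forall (k : R[i]) (x : X), dag (cscale k x) = cscale k^* (dag x) ;
  dagK : involutive dag ;
  dag_act : forall (a : A) (x : X) (b : A),
    dag ((a *: x) ⋅ b) = (star b *: dag x) ⋅ star a
}.

#[short(type="dagBimodType")]
HB.structure Definition DaggerBimodule (R : realType) (A : starAlgType R) :=
  { X of isDaggerBimodule R A X & Bimodule R A X }.

Notation "x ^†" := (dag x) (at level 2, left associativity, format "x ^†") : ring_scope.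

Section Modules.
Context {R : realType} {A : starAlgType R}.
Implicit Types X Y : bimodType A.

Definition left_fg (X : lmodType A) : Prop :=
  exists s : seq X, forall x : X,
    exists c : 'I_(size s) -> A, x = \sum_(i < size s) c i *: s`_i.

Definition left_projective (X : lmodType A) : Prop :=
  forall (M N : lmodType A) (p : {linear M -> N}) (f : {linear X -> N}),
    (forall y, exists x, p x = y) ->
    exists h : {linear X -> M}, forall x, p (h x) = f x.

Definition additive_map (V W : zmodType) (f : V -> W) : Prop :=
  forall x y, f (x + y) = f x + f y.

Definition bimodule_map X Y (f : X -> Y) : Prop :=
  [/\ additive_map f,
      forall (a : A) x, f (a *: x) = a *: f x
    & forall x (a : A), f (x ⋅ a) = f x ⋅ a].

Definition central X (x : X) : Prop := forall a : A, a *: x = x ⋅ a.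

Definition centred X : Prop :=
  forall x : X, exists s : seq (A * X * A),
    (forall p, p \in s -> central p.1.2) /\
    x = \sum_(p <- s) (p.1.1 *: p.1.2) ⋅ p.2.

Lemma ractBl X (a : A) : {morph (fun x : X => x ⋅ a) : x y / x - y}.
Proof.
move=> x y /=; apply: (@addIr _ (y ⋅ a)).
by rewrite -ractDl !subrK.
Qed.

Lemma ract0l X (a : A) : (0 : X) ⋅ a = 0.
Proof. by apply: (@addIr _ (0 ⋅ a)); rewrite -ractDl !add0r. Qed.

Lemma ractNl X (x : X) (a : A) : (- x) ⋅ a = - (x ⋅ a).
Proof. by rewrite -sub0r ractBl ract0l sub0r. Qed.

Lemma ract0r X (x : X) : x ⋅ (0 : A) = 0.
Proof. by apply: (@addIr _ (x ⋅ 0)); rewrite -ractDr !add0r. Qed.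

Lemma ract_suml X (I : Type) (s : seq I) (F : I -> X) (a : A) :
  (\sum_(i <- s) F i) ⋅ a = \sum_(i <- s) F i ⋅ a.
Proof.
by elim: s => [|i s IH]; rewrite ?big_nil ?ract0l // !big_cons ractDl IH.
Qed.

End Modules.

(* X ⊗_A Y is the set of formal finite sums of pairs modulo the congruence    *)
(* generated by biadditivity and (x a, y) ~ (x, a y).                         *)

Inductive tens_eq (R : realType) (A : starAlgType R) (X Y : bimodType A) :
    seq (X * Y) -> seq (X * Y) -> Prop :=
| tens_eq_refl s : tens_eq s s
| tens_eq_sym s t : tens_eq s t -> tens_eq t s
| tens_eq_trans s t u : tens_eq s t -> tens_eq t u -> tens_eq s u
| tens_eq_cat s s' t t' :
    tens_eq s s' -> tens_eq t t' -> tens_eq (s ++ t) (s' ++ t')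
| tens_eq_comm s t : tens_eq (s ++ t) (t ++ s)
| tens_eq_zero y : tens_eq [:: (0, y)] [::]
| tens_eq_addl x x' y : tens_eq [:: (x + x', y)] [:: (x, y); (x', y)]
| tens_eq_addr x y y' : tens_eq [:: (x, y + y')] [:: (x, y); (x, y')]
| tens_eq_bal x (a : A) y : tens_eq [:: (x ⋅ a, y)] [:: (x, a *: y)].

Section Tensor.
Context {R : realType} {A : starAlgType R}.
Variables X Y : bimodType A.

Definition tens_rel (s t : seq (X * Y)) : bool := `[< tens_eq s t >].

Lemma tens_rel_equiv : equiv_class_of tens_rel.
Proof.
split=> [s | s t | t s u].
- by apply/asboolP; exact: tens_eq_refl.
- by apply/asboolP/asboolP => /tens_eq_sym.
- by move=> /asboolP st /asboolP tu; apply/asboolP; exact: tens_eq_trans st tu.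
Qed.

Canonical tens_equiv := EquivRelPack tens_rel_equiv.

Definition tensor : Type := {eq_quot tens_equiv}.
HB.instance Definition _ := Choice.on tensor.
HB.instance Definition _ := EqQuotient.on tensor.

Definition tclass (s : seq (X * Y)) : tensor := \pi_tensor s.

Lemma tclassP s t : tens_eq s t <-> tclass s = tclass t.
Proof.
split=> [st | /eqmodP/asboolP //].
by apply/eqmodP/asboolP.
Qed.

Lemma repr_tens_eq s : tens_eq (repr (tclass s)) s.
Proof. by apply/tclassP; rewrite /tclass reprK. Qed.

Lemma tclassK (t : tensor) : tclass (repr t) = t.
Proof. exact: reprK. Qed.

Definition topp (s : seq (X * Y)) := [seq (- p.1, p.2) | p <- s].
Definition tlact (a : A) (s : seq (X * Y)) := [seq (a *: p.1, p.2) | p <- s].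
Definition tract (s : seq (X * Y)) (a : A) := [seq (p.1, p.2 ⋅ a) | p <- s].

Lemma tens_eq_zeror (x : X) : tens_eq [:: (x, 0 : Y)] [::].
Proof.
have := tens_eq_bal x (0 : A) (0 : Y).
rewrite ract0r scale0r => /tens_eq_sym h.
exact: tens_eq_trans h (tens_eq_zero _ _).
Qed.

Lemma topp_eq s t : tens_eq s t -> tens_eq (topp s) (topp t).
Proof.
elim=> {s t} /=; rewrite /topp.
- by move=> s; exact: tens_eq_refl.
- by move=> s t _; exact: tens_eq_sym.
- by move=> s t u _ IH1 _ IH2; exact: tens_eq_trans IH1 IH2.
- by move=> s s' t t' _ IH1 _ IH2; rewrite !map_cat; exact: tens_eq_cat.
- by move=> s t; rewrite !map_cat; exact: tens_eq_comm.
- by move=> y /=; rewrite oppr0; exact: tens_eq_zero.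
- by move=> x x' y /=; rewrite opprD; exact: tens_eq_addl.
- by move=> x y y' /=; exact: tens_eq_addr.
- by move=> x a y /=; rewrite -ractNl; exact: tens_eq_bal.
Qed.

Lemma tlact_eq a s t : tens_eq s t -> tens_eq (tlact a s) (tlact a t).
Proof.
elim=> {s t} /=; rewrite /tlact.
- by move=> s; exact: tens_eq_refl.
- by move=> s t _; exact: tens_eq_sym.
- by move=> s t u _ IH1 _ IH2; exact: tens_eq_trans IH1 IH2.
- by move=> s s' t t' _ IH1 _ IH2; rewrite !map_cat; exact: tens_eq_cat.
- by move=> s t; rewrite !map_cat; exact: tens_eq_comm.
- by move=> y /=; rewrite scaler0; exact: tens_eq_zero.
- by move=> x x' y /=; rewrite scalerDr; exact: tens_eq_addl.
- by move=> x y y' /=; exact: tens_eq_addr.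
- by move=> x b y /=; rewrite -lractA; exact: tens_eq_bal.
Qed.

Lemma tract_eq a s t : tens_eq s t -> tens_eq (tract s a) (tract t a).
Proof.
elim=> {s t} /=; rewrite /tract.
- by move=> s; exact: tens_eq_refl.
- by move=> s t _; exact: tens_eq_sym.
- by move=> s t u _ IH1 _ IH2; exact: tens_eq_trans IH1 IH2.
- by move=> s s' t t' _ IH1 _ IH2; rewrite !map_cat; exact: tens_eq_cat.
- by move=> s t; rewrite !map_cat; exact: tens_eq_comm.
- by move=> y /=; exact: tens_eq_zero.
- by move=> x x' y /=; exact: tens_eq_addl.
- by move=> x y y' /=; rewrite ractDl; exact: tens_eq_addr.
- by move=> x b y /=; rewrite lractA; exact: tens_eq_bal.
Qed.

Definition tensor_zero : tensor := tclass [::].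
Definition tensor_add (t u : tensor) : tensor := tclass (repr t ++ repr u).
Definition tensor_opp (t : tensor) : tensor := tclass (topp (repr t)).
Definition tensor_lact (a : A) (t : tensor) : tensor := tclass (tlact a (repr t)).
Definition tensor_ract (t : tensor) (a : A) : tensor := tclass (tract (repr t) a).

Lemma tensor_addE s t : tensor_add (tclass s) (tclass t) = tclass (s ++ t).
Proof. by apply/tclassP; apply: tens_eq_cat; exact: repr_tens_eq. Qed.
Lemma tensor_oppE s : tensor_opp (tclass s) = tclass (topp s).
Proof. by apply/tclassP/topp_eq; exact: repr_tens_eq. Qed.
Lemma tensor_lactE a s : tensor_lact a (tclass s) = tclass (tlact a s).
Proof. by apply/tclassP/tlact_eq; exact: repr_tens_eq. Qed.
Lemma tensor_ractE s a : tensor_ract (tclass s) a = tclass (tract s a).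
Proof. by apply/tclassP/tract_eq; exact: repr_tens_eq. Qed.

Lemma tensor_ind (P : tensor -> Prop) :
  (forall s, P (tclass s)) -> forall t, P t.
Proof. by move=> Ps t; rewrite -(tclassK t). Qed.

Lemma tensor_addA : associative tensor_add.
Proof.
elim/tensor_ind=> s; elim/tensor_ind=> t; elim/tensor_ind=> u.
by rewrite !tensor_addE catA.
Qed.

Lemma tensor_addC : commutative tensor_add.
Proof.
elim/tensor_ind=> s; elim/tensor_ind=> t; rewrite !tensor_addE.
by apply/tclassP; exact: tens_eq_comm.
Qed.

Lemma tensor_add0 : left_id tensor_zero tensor_add.
Proof. by elim/tensor_ind=> s; rewrite tensor_addE. Qed.

Lemma tclass_cons p s : tclass (p :: s) = tensor_add (tclass [:: p]) (tclass s).
Proof. by rewrite tensor_addE. Qed.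

Lemma tensor_addN : left_inverse tensor_zero tensor_opp tensor_add.
Proof.
elim/tensor_ind; elim=> [|[x y] s IH]; first by rewrite tensor_oppE tensor_addE.
have -> : tensor_opp (tclass ((x, y) :: s)) =
          tensor_add (tclass [:: (- x, y)]) (tensor_opp (tclass s)).
  by rewrite !tensor_oppE tensor_addE.
rewrite (tclass_cons (x, y)) tensor_addA.
rewrite -(tensor_addA (tclass [:: (- x, y)])) (tensor_addC _ (tclass [:: (x, y)])).
rewrite tensor_addA -(tensor_addA _ _ (tclass s)) IH tensor_addE.
rewrite (tensor_addC _ tensor_zero) tensor_add0; apply/tclassP.
apply: tens_eq_trans _ (tens_eq_zero X y); rewrite -(addNr x).
exact/tens_eq_sym/tens_eq_addl.
Qed.

HB.instance Definition _ := GRing.isZmodule.Build tensor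
  tensor_addA tensor_addC tensor_add0 tensor_addN.

Definition tens (x : X) (y : Y) : tensor := tclass [:: (x, y)].

Lemma tclassE s : tclass s = \sum_(p <- s) tens p.1 p.2.
Proof.
elim: s => [|[x y] s IH]; first by rewrite big_nil.
by rewrite big_cons -IH tclass_cons.
Qed.

Lemma tensorE (t : tensor) : t = \sum_(p <- repr t) tens p.1 p.2.
Proof. by rewrite -tclassE tclassK. Qed.

Lemma tensDl x x' y : tens (x + x') y = tens x y + tens x' y.
Proof.
rewrite [RHS]tensor_addE; apply/tclassP; exact: tens_eq_addl.
Qed.
Lemma tensDr x y y' : tens x (y + y') = tens x y + tens x y'.
Proof.
rewrite [RHS]tensor_addE; apply/tclassP; exact: tens_eq_addr.
Qed.
Lemma tens_bal x (a : A) y : tens (x ⋅ a) y = tens x (a *: y).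
Proof. by apply/tclassP; exact: tens_eq_bal. Qed.

Lemma tensor_lactD a : {morph tensor_lact a : t u / t + u}.
Proof.
elim/tensor_ind=> s; elim/tensor_ind=> t.
rewrite [tclass s + _]tensor_addE !tensor_lactE [RHS]tensor_addE.
by rewrite /tlact map_cat.
Qed.

Lemma tensor_ractD a : {morph tensor_ract^~ a : t u / t + u}.
Proof.
elim/tensor_ind=> s; elim/tensor_ind=> t.
rewrite [tclass s + _]tensor_addE !tensor_ractE [RHS]tensor_addE.
by rewrite /tract map_cat.
Qed.

Lemma tensor_lact_tens a x y : tensor_lact a (tens x y) = tens (a *: x) y.
Proof. exact: tensor_lactE. Qed.
Lemma tensor_ract_tens x y a : tensor_ract (tens x y) a = tens x (y ⋅ a).
Proof. exact: tensor_ractE. Qed.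

Lemma tens_additive_ext (V : zmodType) (f h : tensor -> V) :
  additive_map f -> additive_map h ->
  (forall x y, f (tens x y) = h (tens x y)) -> f =1 h.
Proof.
move=> fD hD fh t; rewrite (tensorE t).
have f0 : f 0 = 0 by apply: (@addIr _ (f 0)); rewrite -fD !add0r.
have h0 : h 0 = 0 by apply: (@addIr _ (h 0)); rewrite -hD !add0r.
elim: (repr t) => [|p s IH]; rewrite ?big_nil ?f0 ?h0 //.
by rewrite !big_cons fD hD fh IH.
Qed.

Lemma tensor_lactA a b t :
  tensor_lact a (tensor_lact b t) = tensor_lact (a * b) t.
Proof.
move: t; apply: tens_additive_ext => [t u | t u | x y].
- by rewrite !tensor_lactD.
- by rewrite tensor_lactD.
- by rewrite !tensor_lact_tens scalerA.
Qed.

Lemma tensor_lact1 : left_id 1 tensor_lact.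
Proof.
apply: tens_additive_ext => [t u | // | x y]; first by rewrite tensor_lactD.
by rewrite tensor_lact_tens scale1r.
Qed.

Lemma tensor_lactDl t : {morph tensor_lact^~ t : a b / a + b}.
Proof.
move=> a b; move: t; apply: tens_additive_ext => [t u | t u | x y].
- by rewrite tensor_lactD.
- by rewrite !tensor_lactD addrACA.
- by rewrite !tensor_lact_tens scalerDl tensDl.
Qed.

HB.instance Definition _ := GRing.Zmodule_isLmodule.Build A tensor
  tensor_lactA tensor_lact1 tensor_lactD tensor_lactDl.

Lemma tensor_ractDl (t u : tensor) a :
  tensor_ract (t + u) a = tensor_ract t a + tensor_ract u a.
Proof. exact: tensor_ractD. Qed.

Lemma tensor_ractDr (t : tensor) a b :
  tensor_ract t (a + b) = tensor_ract t a + tensor_ract t b.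
Proof.
move: t; apply: tens_additive_ext => [t u | t u | x y].
- by rewrite tensor_ractD.
- by rewrite !tensor_ractD addrACA.
- by rewrite !tensor_ract_tens ractDr tensDr.
Qed.

Lemma tensor_ractA (t : tensor) a b :
  tensor_ract t (a * b) = tensor_ract (tensor_ract t a) b.
Proof.
move: t; apply: tens_additive_ext => [t u | t u | x y].
- by rewrite tensor_ractD.
- by rewrite !tensor_ractD.
- by rewrite !tensor_ract_tens ractA.
Qed.

Lemma tensor_ract1 (t : tensor) : tensor_ract t 1 = t.
Proof.
move: t; apply: tens_additive_ext => [t u | // | x y]; first by rewrite tensor_ractD.
by rewrite tensor_ract_tens ract1.
Qed.

Lemma tensor_lractA a (t : tensor) b :
  tensor_ract (a *: t) b = a *: tensor_ract t b.
Proof.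
move: t; apply: tens_additive_ext => [t u | t u | x y].
- by rewrite scalerDr tensor_ractD.
- by rewrite tensor_ractD scalerDr.
- by rewrite [a *: _]tensor_lact_tens !tensor_ract_tens [RHS]tensor_lact_tens.
Qed.

Lemma tensor_ract_scalar (k : R[i]) (t : tensor) :
  tensor_ract t (k ∙ 1) = (k ∙ 1) *: t.
Proof.
move: t; apply: tens_additive_ext => [t u | t u | x y].
- by rewrite tensor_ractD.
- by rewrite scalerDr.
- rewrite tensor_ract_tens [RHS]tensor_lact_tens.
  by rewrite ract_scalar -tens_bal ract_scalar.
Qed.

HB.instance Definition _ := isBimodule.Build R A tensor
  tensor_ractDl tensor_ractDr tensor_ractA tensor_ract1 tensor_lractA
  tensor_ract_scalar.

Lemma lact_tens (a : A) x y : a *: tens x y = tens (a *: x) y.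
Proof. exact: tensor_lact_tens. Qed.
Lemma ract_tens x y (a : A) : tens x y ⋅ a = tens x (y ⋅ a).
Proof. exact: tensor_ract_tens. Qed.

Lemma cscale_tens (k : R[i]) x y : cscale k (tens x y) = tens (cscale k x) y.
Proof. exact: lact_tens. Qed.

(* tlift f is the additive map x ⊗ y |-> f x y; it is meaningful for balanced *)
(* f only, see tlift_tens.                                                    *)

Definition balanced (V : zmodType) (f : X -> Y -> V) : Prop :=
  [/\ forall x x' y, f (x + x') y = f x y + f x' y,
      forall x y y', f x (y + y') = f x y + f x y'
    & forall x (a : A) y, f (x ⋅ a) y = f x (a *: y)].

Definition tlift (V : zmodType) (f : X -> Y -> V) (t : tensor) : V :=
  \sum_(p <- repr t) f p.1 p.2.

Lemma tlift_tclass (V : zmodType) (f : X -> Y -> V) s : balanced f ->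
  tlift f (tclass s) = \sum_(p <- s) f p.1 p.2.
Proof.
case=> fDl fDr fb; rewrite /tlift.
have := repr_tens_eq s; move: (repr _) => t st.
elim: st => {s t} //=.
- by move=> ? ? ? _ -> _ ->.
- by move=> ? ? ? ? _ IH1 _ IH2; rewrite !big_cat /= IH1 IH2.
- by move=> ? ?; rewrite !big_cat /= addrC.
- move=> y; rewrite big_cons !big_nil /= addr0.
  by apply: (@addIr _ (f 0 y)); rewrite -fDl !add0r.
- by move=> x x' y; rewrite !big_cons !big_nil /= !addr0 fDl.
- by move=> x y y'; rewrite !big_cons !big_nil /= !addr0 fDr.
- by move=> x a y; rewrite !big_cons !big_nil /= fb.
Qed.

Lemma tlift_tens (V : zmodType) (f : X -> Y -> V) x y : balanced f ->
  tlift f (tens x y) = f x y.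
Proof. by move=> fb; rewrite tlift_tclass // big_seq1. Qed.

Lemma tliftD (V : zmodType) (f : X -> Y -> V) : balanced f ->
  additive_map (tlift f).
Proof.
move=> fb; elim/tensor_ind=> s; elim/tensor_ind=> t.
by rewrite [tclass s + _]tensor_addE !tlift_tclass // big_cat.
Qed.

End Tensor.

Arguments tens {R A X Y} x y.
Arguments tlift {R A X Y V} f t.
Notation "x ⊗ y" := (tens x y) (at level 40, left associativity) : ring_scope.

Section TensorMaps.
Context {R : realType} {A : starAlgType R}.

Definition tmap (X X' Y Y' : bimodType A) (f : X -> X') (h : Y -> Y') :
    tensor X Y -> tensor X' Y' :=
  tlift (fun x y => f x ⊗ h y).

Lemma tmap_balanced (X X' Y Y' : bimodType A) (f : X -> X') (h : Y -> Y') :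
  bimodule_map f -> bimodule_map h -> balanced (fun x y => f x ⊗ h y).
Proof.
move=> [fD fl fr] [hD hl hr]; split=> [x x' y | x y y' | x a y].
- by rewrite fD tensDl.
- by rewrite hD tensDr.
- by rewrite fr hl tens_bal.
Qed.

Lemma tmap_tens (X X' Y Y' : bimodType A) (f : X -> X') (h : Y -> Y') x y :
  bimodule_map f -> bimodule_map h -> tmap f h (x ⊗ y) = f x ⊗ h y.
Proof. by move=> fb hb; rewrite /tmap tlift_tens //; exact: tmap_balanced. Qed.

Definition tassoc (X Y Z : bimodType A) :
    tensor (tensor X Y) Z -> tensor X (tensor Y Z) :=
  tlift (fun t z => tlift (fun x y => x ⊗ (y ⊗ z)) t).

Definition tassoc_inv (X Y Z : bimodType A) :
    tensor X (tensor Y Z) -> tensor (tensor X Y) Z :=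
  tlift (fun x t => tlift (fun y z => (x ⊗ y) ⊗ z) t).

Lemma tassoc_tens (X Y Z : bimodType A) (x : X) (y : Y) (z : Z) :
  tassoc ((x ⊗ y) ⊗ z) = x ⊗ (y ⊗ z).
Proof.
have bal1 (w : Z) : balanced (fun (x : X) (y : Y) => x ⊗ (y ⊗ w)).
  split=> [? ? ? | ? ? ? | ? a ?]; first by rewrite tensDl.
    by rewrite tensDl tensDr.
  by rewrite tens_bal lact_tens.
rewrite /tassoc tlift_tens; first by rewrite tlift_tens.
split=> [t t' w | t w w' | t a w].
- exact: tliftD.
- by rewrite -big_split /=; apply: eq_bigr => p _; rewrite !tensDr.
- move: t; apply: tens_additive_ext => [t u | t u | u v].
  + by rewrite ractDl; exact: tliftD.
  + exact: tliftD.
  + by rewrite ract_tens !tlift_tens // tens_bal.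
Qed.

Lemma tassoc_inv_tens (X Y Z : bimodType A) (x : X) (y : Y) (z : Z) :
  tassoc_inv (x ⊗ (y ⊗ z)) = (x ⊗ y) ⊗ z.
Proof.
have bal1 (w : X) : balanced (fun (y : Y) (z : Z) => (w ⊗ y) ⊗ z).
  split=> [? ? ? | ? ? ? | ? a ?]; first by rewrite tensDr tensDl.
    by rewrite tensDr.
  by rewrite -tens_bal ract_tens.
rewrite /tassoc_inv tlift_tens; first by rewrite tlift_tens.
split=> [w w' t | w t t' | w a t].
- by rewrite -big_split /=; apply: eq_bigr => p _; rewrite !tensDl.
- exact: tliftD.
- move: t; apply: tens_additive_ext => [t u | t u | u v].
  + exact: tliftD.
  + by rewrite scalerDr; exact: tliftD.
  + by rewrite lact_tens !tlift_tens // tens_bal.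
Qed.

Lemma cscaleD (X : bimodType A) (k : R[i]) (x y : X) :
  cscale k (x + y) = cscale k x + cscale k y.
Proof. exact: scalerDr. Qed.

Lemma star1 : star (1 : A) = 1.
Proof. by have := starM (star 1) (1 : A); rewrite mulr1 starK mulr1 => <-. Qed.

Lemma star_scalar (k : R[i]) : star (k ∙ 1 : A) = k^* ∙ 1.
Proof. by rewrite starZ star1. Qed.

Lemma dag_lact (X : dagBimodType A) (a : A) (x : X) :
  (a *: x)^† = x^† ⋅ star a.
Proof. by rewrite -(ract1 (a *: x)) dag_act star1 scale1r. Qed.

Lemma dag_ract (X : dagBimodType A) (x : X) (a : A) :
  (x ⋅ a)^† = star a *: x^†.
Proof. by rewrite -[x in LHS]scale1r dag_act star1 ract1. Qed.

Variable X : dagBimodType A.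

Definition dag2 : tensor X X -> tensor X X := tlift (fun x y => y^† ⊗ x^†).

Lemma dag2_balanced : balanced (fun x y : X => y^† ⊗ x^†).
Proof.
split=> [x x' y | x y y' | x a y].
- by rewrite dagD tensDr.
- by rewrite dagD tensDl.
- by rewrite dag_ract dag_lact tens_bal.
Qed.

Lemma dag2_tens x y : dag2 (x ⊗ y) = y^† ⊗ x^†.
Proof. by rewrite /dag2 tlift_tens //; exact: dag2_balanced. Qed.

Lemma dag2D (t u : tensor X X) : dag2 (t + u) = dag2 t + dag2 u.
Proof. exact: tliftD dag2_balanced _ _. Qed.

Lemma dag2_act (a : A) (t : tensor X X) (b : A) :
  dag2 ((a *: t) ⋅ b) = (star b *: dag2 t) ⋅ star a.
Proof.
move: t; apply: tens_additive_ext => [t u | t u | x y].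
- by rewrite scalerDr ractDl dag2D.
- by rewrite dag2D scalerDr ractDl.
- by rewrite lact_tens ract_tens !dag2_tens dag_ract dag_lact lact_tens ract_tens.
Qed.

Lemma dag2Z (k : R[i]) (t : tensor X X) :
  dag2 (cscale k t) = cscale k^* (dag2 t).
Proof.
rewrite /cscale -(ract1 (_ *: t)) dag2_act star1 scale1r star_scalar.
exact: ract_scalar.
Qed.

Lemma dag2K : involutive dag2.
Proof.
apply: tens_additive_ext => [t u | // | x y]; first by rewrite !dag2D.
by rewrite !dag2_tens !dagK.
Qed.

HB.instance Definition _ := isDaggerBimodule.Build R A (tensor X X)
  dag2D dag2Z dag2K dag2_act.

End TensorMaps.

Record hermitianFODS (R : realType) (A : starAlgType R) := HermitianFODS {
  Omega :> dagBimodType A ;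
  diff : A -> Omega ;
  diff_linear : forall (k : R[i]) (a b : A),
    diff (k ∙ a + b) = cscale k (diff a) + diff b ;
  diff_leibniz : forall a b : A, diff (a * b) = diff a ⋅ b + a *: diff b ;
  diff_star : forall a : A, diff (star a) = - (diff a)^† ;
  diff_span : forall w : Omega,
    exists s : seq (A * A), w = \sum_(p <- s) p.1 *: diff p.2 ;
  Omega_fg : left_fg Omega ;
  Omega_projective : left_projective Omega ;
  ip : Omega -> Omega -> A ;
  ipDl : forall w w' e, ip (w + w') e = ip w e + ip w' e ;
  ipDr : forall w e e', ip w (e + e') = ip w e + ip w e' ;
  ip_ract : forall w e (a : A), ip w (e ⋅ a) = ip w e * a ;
  ip_star : forall w e, star (ip w e) = ip e w ;
  ip_lact : forall (a : A) w e, ip (a *: w) e = ip w (star a *: e) ;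
  (* Strong non-degeneracy.  Additivity of w |-> <w^†|-> and right linearity  *)
  (* of its values are contained in the previous fields.                      *)
  ip_left_linear : forall (a : A) w e, ip (a *: w)^† e = a * ip w^† e ;
  ip_inj : forall w w', (forall e, ip w^† e = ip w'^† e) -> w = w' ;
  ip_surj : forall f : Omega -> A,
    additive_map f -> (forall e (a : A), f (e ⋅ a) = f e * a) ->
    exists w, forall e, ip w^† e = f e
}.

Section FirstOrder.
Context {R : realType} {A : starAlgType R}.
Variable H : hermitianFODS A.

Local Notation T2 := (tensor H H).
Local Notation T3 := (tensor (tensor H H) H).
Local Notation d := (@diff _ _ H).
Local Notation "⟪ x | y ⟫" := (@ip _ _ H x y) (x at level 99).

Definition is_sigma_can (sigma : T2 -> T2) : Prop :=
  [/\ bimodule_map sigma,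
      exists sigma_inv : T2 -> T2,
        [/\ cancel sigma sigma_inv, cancel sigma_inv sigma
          & forall t : T2, sigma_inv t^† = (sigma t)^†]
    & forall w e : H, central w \/ central e -> sigma (w ⊗ e) = e ⊗ w].

Definition metric : T2 -> A := tlift (fun w e : H => - ⟪ w^† | e ⟫).

Definition junk2 (t : T2) : Prop :=
  exists s : seq (A * A),
    \sum_(p <- s) p.1 *: d p.2 = 0 /\ t = \sum_(p <- s) d p.1 ⊗ d p.2.

Definition alpha (T : T3) (w : H) : T2 :=
  tlift (fun (t : T2) (v : H) => t ⋅ ⟪ v^† | w ⟫) T.

Definition ip_right (w : H) (t : T2) : H :=
  tlift (fun e r : H => ⟪ w | e ⟫ *: r) t.

Definition ip_left (t : T2) (w : H) : H :=
  tlift (fun e r : H => r^† ⋅ ⟪ e | w ⟫) t.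

Definition right_connection (nabla : H -> T2) : Prop :=
  (forall (k : R[i]) (w e : H),
     nabla (cscale k w + e) = cscale k (nabla w) + nabla e) /\
  (forall (w : H) (a : A), nabla (w ⋅ a) = nabla w ⋅ a + w ⊗ d a).

Definition hermitian_connection (nabla : H -> T2) : Prop :=
  forall w e : H,
    - ip_left (nabla w) e + ip_right w (nabla e) = d ⟪ w | e ⟫.

Lemma metric_tens (w e : H) : metric (w ⊗ e) = - ⟪ w^† | e ⟫.
Proof.
rewrite /metric tlift_tens //; split=> [x x' y | x y y' | x a y].
- by rewrite dagD ipDl opprD.
- by rewrite ipDr opprD.
- by rewrite dag_ract ip_lact starK.
Qed.

Lemma alpha_tens (t : T2) (v w : H) : alpha (t ⊗ v) w = t ⋅ ⟪ v^† | w ⟫.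
Proof.
rewrite /alpha tlift_tens //; split=> [x x' y | x y y' | x a y].
- by rewrite ractDl.
- by rewrite dagD ipDl ractDr.
- by rewrite ip_left_linear ractA.
Qed.

Lemma ip_right_tens (w e r : H) : ip_right w (e ⊗ r) = ⟪ w | e ⟫ *: r.
Proof.
rewrite /ip_right tlift_tens //; split=> [x x' y | x y y' | x a y].
- by rewrite ipDr scalerDl.
- by rewrite scalerDr.
- by rewrite ip_ract scalerA.
Qed.

Lemma ip_left_tens (e r w : H) : ip_left (e ⊗ r) w = r^† ⋅ ⟪ e | w ⟫.
Proof.
rewrite /ip_left tlift_tens //; split=> [x x' y | x y y' | x a y].
- by rewrite ipDl ractDr.
- by rewrite dagD ractDl.
- by rewrite dag_lact -ractA -[⟪ x ⋅ a | w ⟫]ip_star ip_ract starM ip_star.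
Qed.

End FirstOrder.

Arguments metric {R A} H.
Arguments junk2 {R A} H.
Arguments is_sigma_can {R A} H.

Section Psi.
Context {R : realType} {A : starAlgType R}.
Variable H : hermitianFODS A.
Variable sigma : tensor H H -> tensor H H.

Definition Psi_of (t : tensor H H) : tensor H H := cscale 2^-1 (t + sigma t).

End Psi.

Record centredHermitianCalculus (R : realType) (A : starAlgType R) :=
  CentredHermitianCalculus {
    fods :> hermitianFODS A ;
    sigma : tensor fods fods -> tensor fods fods ;
    Omega_centred : centred fods ;
    sigma_canP : is_sigma_can fods sigma ;
    metric_sigma : forall t, metric fods (sigma t) = metric fods t ;
    junk_Psi : forall t, junk2 fods t -> exists u, t = Psi_of sigma u
  }.

Section Calculus.
Context {R : realType} {A : starAlgType R}.
Variable H : centredHermitianCalculus A.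

Local Notation T2 := (tensor H H).
Local Notation T3 := (tensor (tensor H H) H).
Local Notation d := (@diff _ _ (fods H)).

Definition Psi : T2 -> T2 := Psi_of (@sigma _ _ H).

Definition Pproj : T3 -> T3 := tmap Psi id.

Definition Qproj (T : T3) : T3 := tassoc_inv (tmap id Psi (tassoc T)).

(* d_Psi is computed on a chosen expression \sum_i a_i (d b_i); d_PsiE states *)
(* that the value does not depend on it.                                      *)

Definition diff_expr (w : H) : seq (A * A) := projT1 (cid (diff_span w)).

Definition d_Psi (w : H) : T2 :=
  let t := \sum_(p <- diff_expr w) d p.1 ⊗ d p.2 in t - Psi t.

Lemma sigmaK (t : T2) : sigma (sigma t) = t.
Proof.
have [[sD sl sr] _ sflip] := @sigma_canP _ _ H.
move: t; apply: tens_additive_ext => [t u | // | x y]; first by rewrite !sD.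
have [s [sc ->]] := Omega_centred x.
have tens_suml (r : seq (A * H * A)) (F : A * H * A -> H) :
    (\sum_(p <- r) F p) ⊗ y = \sum_(p <- r) F p ⊗ y.
  elim: r => [|p r IH]; last by rewrite !big_cons tensDl IH.
  by rewrite !big_nil; apply: (@addIr _ (0 ⊗ y)); rewrite -tensDl !add0r.
have s0 : @sigma _ _ H 0 = 0.
  by apply: (@addIr _ (sigma 0)); rewrite -sD !add0r.
rewrite tens_suml; elim: s sc => [|p s IH] sc; first by rewrite big_nil !s0.
rewrite big_cons !sD IH; last by move=> q qs; apply: sc; rewrite inE qs orbT.
have pc : central p.1.2 by apply: sc; rewrite inE eqxx.
congr (_ + _); rewrite tens_bal -lact_tens !sl.
by rewrite sflip; [rewrite sflip //; right | left].
Qed.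

Lemma PsiK (t : T2) : Psi (Psi t) = Psi t.
Proof.
have [[sD sl _] _ _] := @sigma_canP _ _ H.
rewrite /Psi /Psi_of /cscale sl sD sigmaK [sigma t + t]addrC -scalerDl.
have -> : (2^-1 : R[i]) ∙ (1 : A) + 2^-1 ∙ 1 = 1.
  rewrite -cmulDl -[X in X ∙ _]mulr2n -[X in X ∙ _]mulr_natr.
  by rewrite mulVf ?pnatr_eq0 // cmul1.
by rewrite scale1r.
Qed.

Lemma PsiB (t u : T2) : Psi (t - u) = Psi t - Psi u.
Proof.
have [[sD _ _] _ _] := @sigma_canP _ _ H.
apply: (@addIr _ (Psi u)); rewrite subrK /Psi /Psi_of -cscaleD.
by rewrite addrACA -sD !subrK.
Qed.

Lemma diffN (a : A) : d (- a) = - d a.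
Proof.
have dD (x y : A) : d (x + y) = d x + d y.
  by rewrite -{1}(cmul1 x) diff_linear /cscale cmul1 scale1r.
have d0 : d 0 = 0 by apply: (@addIr _ (d 0)); rewrite -dD !add0r.
by apply: (@addIr _ (d a)); rewrite -dD !addNr.
Qed.

Lemma d_PsiE (s : seq (A * A)) :
  let t := \sum_(p <- s) d p.1 ⊗ d p.2 in
  d_Psi (\sum_(p <- s) p.1 *: d p.2) = t - Psi t.
Proof.
move=> t; rewrite /d_Psi /diff_expr; case: cid => s0 /= ws.
set t0 := \sum_(p <- s0) _.
have tensNl (x y : H) : (- x) ⊗ y = - (x ⊗ y).
  apply: (@addIr _ (x ⊗ y)); rewrite -tensDl !addNr.
  by apply: (@addIr _ (0 ⊗ y)); rewrite -tensDl !add0r.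
have [|u tu] := @junk_Psi _ _ H (t - t0).
  exists (s ++ [seq (- p.1, p.2) | p <- s0]); split.
    rewrite big_cat big_map /= ws -[RHS](subrr (\sum_(p <- s0) p.1 *: d p.2)).
    by congr (_ + _); rewrite -sumrN; apply: eq_bigr => p _; rewrite scaleNr.
  rewrite big_cat big_map /=; congr (_ + _).
  by rewrite -sumrN; apply: eq_bigr => p _; rewrite diffN tensNl.
apply/esym/eqP; rewrite -subr_eq0; apply/eqP.
have -> : t - Psi t - (t0 - Psi t0) = (t - t0) - Psi (t - t0).
  by rewrite PsiB (opprD t0) addrACA (opprD (Psi t)).
by rewrite tu -/(Psi u) PsiK subrr.
Qed.

Lemma Psi_bimodule_map : bimodule_map Psi.
Proof.
have [[sD sl sr] _ _] := @sigma_canP _ _ H.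
split=> [t u | a t | t a].
- by rewrite /Psi /Psi_of sD -cscaleD addrACA.
- rewrite /Psi /Psi_of sl -scalerDr /cscale !scalerA; congr (_ *: _).
  by rewrite -cmul_mull mul1r -cmul_mulr mulr1.
- by rewrite /Psi /Psi_of sr -ractDl /cscale lractA.
Qed.

Lemma Pproj_tens (x y z : H) : Pproj (x ⊗ y ⊗ z) = Psi (x ⊗ y) ⊗ z.
Proof. by rewrite /Pproj tmap_tens //; exact: Psi_bimodule_map. Qed.

Lemma Qproj_tens (x y z : H) : Qproj (x ⊗ y ⊗ z) = tassoc_inv (x ⊗ Psi (y ⊗ z)).
Proof.
by rewrite /Qproj tassoc_tens tmap_tens //; exact: Psi_bimodule_map.
Qed.

Definition torsion_free (nabla : H -> T2) : Prop :=
  forall w : H, (nabla w - Psi (nabla w)) + d_Psi w = 0.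

Definition sigma_dagger_connection (nabla : H -> T2) : Prop :=
  forall w : H, sigma (nabla w) = - (nabla w^†)^†.

Definition levi_civita (nabla : H -> T2) : Prop :=
  [/\ right_connection nabla, hermitian_connection nabla,
      torsion_free nabla & sigma_dagger_connection nabla].

Definition central_frame (s : {fset H * H}) : Prop :=
  [/\ forall p, p \in s -> central p.1 /\ central p.2,
      [fset (p.1^†, p.2^†) | p in s]%fset = s,
      forall w : H, w = \sum_(p <- s) p.1 ⋅ ip p.2 w
    & forall w : H, w = \sum_(p <- s) p.2 ⋅ ip p.1 w].

Definition W_tensor (s : {fset H * H}) : T3 :=
  cscale 2^-1 (\sum_(p <- s) (d_Psi p.1 ⊗ p.2^† + d_Psi p.2 ⊗ p.1^†)).

End Calculus.

(* Main.v *)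
(* A right connection is determined by its values on central one-forms, and a  *)
(* two-tensor [t] by the numbers [pair2 x y t], which send [u ⊗ v] to          *)
(* [-g(x ⊗ u) * -g(y ⊗ v)], for [x], [y] central.  On central forms the        *)
(* canonical flip just swaps the arguments of [pair2], so the classical        *)
(* arguments apply to [F x y w := pair2 x y (nabla w)]: torsion freeness fixes *)
(* the part of [F] antisymmetric in [x], [y], the two remaining conditions     *)
(* give [F x y w + F w y x = - g(y ⊗ d <w^†|x>)], and together they determine  *)
(* [F] by Koszul's formula.                                                    *)
(* The existence does not use a central frame.  Koszul's expression satisfies *)
(* the Leibniz rule in [w], and its part symmetric in [x], [y] can be written  *)
(* right linearly in [y], for arbitrary and not only central arguments; hence  *)
(* strong non-degeneracy represents it by a two-tensor.                        *)
(* For a central frame, [nabla = grassmann + alpha V] with [V] antisymmetric   *)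
(* in its outer arguments and [W = P V - V]; the formula [V = -(1 + 4 P Q) W]  *)
(* is then an identity in the group algebra of S_3.                            *)

(* Central forms play the part of vector fields. Minus the quantum metric, [bil], is symmetric once
   one argument is central, takes central values on them, and [sigma] merely swaps their slots. As
   $\Omega$ is centred and the pairing strongly non-degenerate, they separate two-tensors
   ([pair2_inj]).

   Uniqueness ([levi_civita_unique]): the difference of two solutions, paired with central forms, is
   symmetric in its first two arguments ([torsion_free_pair2]) and antisymmetric in the outer two
   ([hermitian_pair2]), hence zero.

   Existence: at a central [c] the part of Koszul's expression symmetric in [x], [y] is tensorial
   ([koszul_sym_ract]), so it comes from a two-tensor ([koszul_sym_represented]). The Leibniz rule
   extends this to all forms ([koszul_represented]), and the axioms are read off the pairings.

   Formula: [nabla] and the Grassmann connection of the frame obey the same metric identity, so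
   their difference is antisymmetric in its outer arguments ([christoffel_anti]), while
   torsion-freeness relates it to $W$ ([W_tensor_christoffel]); [levi_civita_formula] solves for
   it. *)
From HB Require Import structures.
Require Import Defs.
From mathcomp Require Import all_boot all_order all_algebra finmap.
From mathcomp Require Import boolp reals complex.

Set Implicit Arguments.
Unset Strict Implicit.
Unset Printing Implicit Defensive.

Import GRing.Theory Num.Theory.
Local Open Scope ring_scope.

(** * Linear identities in abelian groups *)

(* An equation in an abelian group is decided by comparing the multisets of   *)
(* the atoms that occur positively and negatively on the two sides.           *)
Inductive zexpr :=
  | ZAtom of nat | ZZero | ZAdd of zexpr & zexpr | ZOpp of zexpr
  | ZDbl of zexpr.

Section Reflection.
Variable V : zmodType.
Implicit Type e : zexpr.

Fixpoint zeval (xs : seq V) e : V :=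
  match e with
  | ZAtom i => xs`_i
  | ZZero => 0
  | ZAdd e1 e2 => zeval xs e1 + zeval xs e2
  | ZOpp e1 => - zeval xs e1
  | ZDbl e1 => zeval xs e1 *+ 2
  end.

Fixpoint zparts e : seq nat * seq nat :=
  match e with
  | ZAtom i => ([:: i], [::])
  | ZZero => ([::], [::])
  | ZAdd e1 e2 => ((zparts e1).1 ++ (zparts e2).1, (zparts e1).2 ++ (zparts e2).2)
  | ZOpp e1 => ((zparts e1).2, (zparts e1).1)
  | ZDbl e1 => ((zparts e1).1 ++ (zparts e1).1, (zparts e1).2 ++ (zparts e1).2)
  end.

Lemma zevalE xs e :
  zeval xs e = \sum_(i <- (zparts e).1) xs`_i - \sum_(i <- (zparts e).2) xs`_i.
Proof.
elim: e => [i||e1 IH1 e2 IH2|e IH|e IH] /=.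
- by rewrite big_seq1 big_nil subr0.
- by rewrite !big_nil subr0.
- by rewrite !big_cat /= opprD addrACA -IH1 -IH2.
- by rewrite IH opprB.
- by rewrite !big_cat /= opprD addrACA -IH mulr2n.
Qed.

Lemma zeval_eq xs e1 e2 :
  perm_eq ((zparts e1).1 ++ (zparts e2).2) ((zparts e2).1 ++ (zparts e1).2) ->
  zeval xs e1 = zeval xs e2.
Proof.
move=> pe; rewrite !zevalE; apply/eqP.
by rewrite subr_eq addrAC eq_sym subr_eq -!big_cat /= (perm_big _ pe).
Qed.

End Reflection.

(* The same atom may occur with several canonical-instance paths, hence the   *)
(* comparison up to conversion.                                               *)
Ltac zindex x xs :=
  match xs with
  | x :: _ => constr:(0%N)
  | ?y :: _ =>
      let _ := match goal with _ => unify x y end in constr:(0%N)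
  | _ :: ?xs' => let n := zindex x xs' in constr:(S n)
  end.

Ltac zinsert x xs :=
  match goal with
  | _ => let _ := zindex x xs in xs
  | _ => constr:(x :: xs)
  end.

Ltac zatoms t xs :=
  lazymatch t with
  | GRing.zero => xs
  | GRing.add ?a ?b => let ys := zatoms a xs in zatoms b ys
  | GRing.opp ?a => zatoms a xs
  | GRing.natmul ?a 2 => zatoms a xs
  | _ => zinsert t xs
  end.

Ltac zreify t xs :=
  lazymatch t with
  | GRing.zero => constr:(ZZero)
  | GRing.add ?a ?b =>
      let u := zreify a xs in let v := zreify b xs in constr:(ZAdd u v)
  | GRing.opp ?a => let u := zreify a xs in constr:(ZOpp u)
  | GRing.natmul ?a 2 => let u := zreify a xs in constr:(ZDbl u)
  | _ => let n := zindex t xs in constr:(ZAtom n)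
  end.

Ltac zmodule :=
  lazymatch goal with
  | |- @eq ?T ?x ?y =>
      let nil0 := constr:(@nil T) in
      let xs := zatoms x nil0 in
      let xs := zatoms y xs in
      let e1 := zreify x xs in
      let e2 := zreify y xs in
      apply: (@zeval_eq _ xs e1 e2); vm_compute; reflexivity
  end.

(** * Additive maps and division by two *)

Section AdditiveMaps.
Variables (V W : zmodType) (f : V -> W).
Hypothesis fD : additive_map f.

Lemma additive_map0 : f 0 = 0.
Proof. by apply: (@addIr _ (f 0)); rewrite -fD !add0r. Qed.

Lemma additive_mapN x : f (- x) = - f x.
Proof. by apply: (@addIr _ (f x)); rewrite -fD !addNr additive_map0. Qed.

Lemma additive_mapB x y : f (x - y) = f x - f y.
Proof. by rewrite fD additive_mapN. Qed.

Lemma additive_mapMn x n : f (x *+ n) = f x *+ n.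
Proof.
by elim: n => [|n IH]; rewrite ?mulr0n ?additive_map0 // !mulrS fD IH.
Qed.

Lemma additive_map_sum (I : Type) (r : seq I) (F : I -> V) :
  f (\sum_(i <- r) F i) = \sum_(i <- r) f (F i).
Proof.
by elim: r => [|i r IH]; rewrite ?big_nil ?additive_map0 // !big_cons fD IH.
Qed.

End AdditiveMaps.

Section Halving.
Context {R : realType} {A : starAlgType R}.

Lemma half_double : (2^-1 : R[i]) ∙ (1 : A) + 2^-1 ∙ 1 = 1.
Proof.
rewrite -cmulDl -[X in X ∙ _]mulr2n -[X in X ∙ _]mulr_natr.
by rewrite mulVf ?pnatr_eq0 // cmul1.
Qed.

Lemma cscale_halfK (X : lmodType A) (x : X) : cscale 2^-1 x *+ 2 = x.
Proof. by rewrite /cscale mulr2n -scalerDl half_double scale1r. Qed.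

(** Identities with factors 1/2 are proved after doubling, which brings them within reach of
    [zmodule]. *)
Lemma mulr2n_inj_lmod (X : lmodType A) (x y : X) : x *+ 2 = y *+ 2 -> x = y.
Proof.
move=> xy; rewrite -[x]cscale_halfK -[y]cscale_halfK /cscale.
by rewrite !scalerMnr xy.
Qed.

Lemma mulr2n_inj_alg (a b : A) : a *+ 2 = b *+ 2 -> a = b.
Proof.
move=> ab; rewrite -[a]mul1r -[b]mul1r -half_double !mulrDl -!mulrDr.
by rewrite -!mulr2n ab.
Qed.

Definition central_elt (z : A) := forall a : A, a * z = z * a.

Lemma central_eltD y z : central_elt y -> central_elt z -> central_elt (y + z).
Proof. by move=> yc zc a; rewrite mulrDl mulrDr yc zc. Qed.

Lemma central_eltN z : central_elt z -> central_elt (- z).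
Proof. by move=> zc a; rewrite mulNr mulrN zc. Qed.

End Halving.

(** * Centred bimodules and frames *)

Section Bimodules.
Context {R : realType} {A : starAlgType R}.

Lemma star_additive : additive_map (@star R A).
Proof. exact: starD. Qed.

Lemma dag_additive (X : dagBimodType A) : additive_map (@dag R A X).
Proof. exact: dagD. Qed.

Lemma tens_additivel (X Y : bimodType A) (y : Y) :
  additive_map (fun x : X => x ⊗ y).
Proof. by move=> x x'; exact: tensDl. Qed.

Lemma tens_additiver (X Y : bimodType A) (x : X) :
  additive_map (fun y : Y => x ⊗ y).
Proof. by move=> y y'; exact: tensDr. Qed.

Lemma tens0l (X Y : bimodType A) (y : Y) : (0 : X) ⊗ y = 0.
Proof. exact: additive_map0 (tens_additivel y). Qed.

Lemma tens0r (X Y : bimodType A) (x : X) : x ⊗ (0 : Y) = 0.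
Proof. exact: additive_map0 (tens_additiver x). Qed.

Lemma tensNl (X Y : bimodType A) (x : X) (y : Y) : (- x) ⊗ y = - (x ⊗ y).
Proof. exact: additive_mapN (tens_additivel y) x. Qed.

Lemma tensNr (X Y : bimodType A) (x : X) (y : Y) : x ⊗ (- y) = - (x ⊗ y).
Proof. exact: additive_mapN (tens_additiver x) y. Qed.

Lemma central_dag (X : dagBimodType A) (x : X) : central x -> central x^†.
Proof.
by move=> xc a; rewrite -[a]starK -dag_ract -dag_lact xc.
Qed.

Lemma centred_ind (X : bimodType A) (P : X -> Prop) :
  centred X -> P 0 -> (forall x y, P x -> P y -> P (x + y)) ->
  (forall c a, central c -> P (c ⋅ a)) -> forall x, P x.
Proof.
move=> Xc P0 PD Pc x; have [s [sc ->]] := Xc x.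
elim: s sc => [|p s IH] sc; first by rewrite big_nil.
rewrite big_cons; apply: PD.
  have pc : central p.1.2 by apply: sc; rewrite inE eqxx.
  by rewrite pc -ractA; exact: Pc.
by apply: IH => q qs; apply: sc; rewrite inE qs orbT.
Qed.

Lemma central_elt_act (X : bimodType A) (z : A) (x : X) :
  centred X -> central_elt z -> z *: x = x ⋅ z.
Proof.
move=> Xc zc; move: x; apply: centred_ind => // [|x y hx hy|c a cc].
- by rewrite scaler0 ract0l.
- by rewrite scalerDr ractDl hx hy.
- by rewrite -lractA cc -!ractA zc.
Qed.

(** In [(c ⋅ a) ⊗ y] the coefficient [a] is absorbed by the second factor. *)
Lemma tens_central_ext (X Y : bimodType A) (V : zmodType)
    (f h : tensor X Y -> V) :
  centred X -> additive_map f -> additive_map h ->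
  (forall c y, central c -> f (c ⊗ y) = h (c ⊗ y)) -> f =1 h.
Proof.
move=> Xc fD hD fh; apply: tens_additive_ext => // x y; move: x.
apply: centred_ind => // [|x x' hx hx'|c a cc].
- rewrite (additive_map0 (tens_additivel y)).
  by rewrite (additive_map0 fD) (additive_map0 hD).
- by rewrite tensDl fD hD hx hx'.
- by rewrite tens_bal; exact: fh.
Qed.

(* The dual basis of a projective module, moved to the right through † and    *)
(* turned into vectors by strong non-degeneracy.                              *)
Lemma frame_exists (H : hermitianFODS A) :
  exists (I : finType) (c e : I -> H),
    forall x, x = \sum_i c i ⋅ ip (e i) x.
Proof.
have [s sgen] := @Omega_fg _ _ H.
pose p (v : 'rV[A]_(size s)) : H := \sum_(i < size s) v 0 i *: s`_i.
have plin : linear p.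
  move=> a u v; rewrite /p scaler_sumr -big_split /=; apply: eq_bigr => i _.
  by rewrite !mxE scalerDl scalerA.
pose pL : {linear 'rV[A]_(size s) -> H} :=
  HB.pack p (GRing.isLinear.Build _ _ _ _ p plin).
have [y|h hK] := @Omega_projective _ _ H _ _ pL (idfun : {linear H -> H}).
  have [c ->] := sgen y; exists (\row_i c i); rewrite /= /p.
  by apply: eq_bigr => i _; rewrite mxE.
pose phi i (y : H) := star (h y^† 0 i).
have phiP i : exists w, forall y, ip w^† y = phi i y.
  apply: ip_surj => [x y|y a]; rewrite /phi.
    by rewrite dagD raddfD mxE starD.
  by rewrite dag_ract linearZ mxE starM starK.
exists ('I_(size s) : finType), (fun i : 'I_(size s) => (s`_i)^†),
  (fun i : 'I_(size s) => (projT1 (cid (phiP i)))^†).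
move=> y; rewrite -[LHS]dagK -[y^† in LHS]hK /= /p.
rewrite (additive_map_sum (@dag_additive H)); apply: eq_bigr => i _.
by rewrite dag_lact; case: cid => w /= ->.
Qed.

End Bimodules.

(** * Pairings of tensors with central forms *)

Section Pairings.
Context {R : realType} {A : starAlgType R}.
Variable H : centredHermitianCalculus A.
Implicit Types (x y z w : H) (a : A) (t u : tensor H H).

Local Notation sg := (@sigma _ _ H).

(** This is $-g(x\otimes y)$; unlike [ip] it is bilinear and balanced over $\mathcal A$. *)
Definition bil x y : A := ip x^† y.

Lemma bilDl y : additive_map (bil^~ y).
Proof. by move=> x x'; rewrite /bil dagD ipDl. Qed.

Lemma bilDr x : additive_map (bil x).
Proof. by move=> y y'; rewrite /bil ipDr. Qed.

Lemma bil_lact a x y : bil (a *: x) y = a * bil x y.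
Proof. exact: ip_left_linear. Qed.

Lemma bil_ract x y a : bil x (y ⋅ a) = bil x y * a.
Proof. exact: ip_ract. Qed.

Lemma bil_bal x a y : bil (x ⋅ a) y = bil x (a *: y).
Proof. by rewrite /bil dag_ract ip_lact starK. Qed.

Lemma bil_central_lact x a y : central x -> bil x (a *: y) = a * bil x y.
Proof. by move=> xc; rewrite -bil_bal -xc bil_lact. Qed.

Lemma bil_central x y : central x -> central y -> central_elt (bil x y).
Proof. by move=> xc yc a; rewrite -bil_central_lact // yc bil_ract. Qed.

Lemma bil_sym x y : central x \/ central y -> bil x y = bil y x.
Proof.
have [_ _ sflip] := @sigma_canP _ _ H.
move=> xy; have := metric_sigma (x ⊗ y).
by rewrite sflip // !metric_tens => /oppr_inj.
Qed.

Lemma star_bil x y : star (bil x y) = bil y^† x^†.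
Proof. by rewrite /bil dagK ip_star. Qed.

Lemma ip_bil x y : ip x y = bil x^† y.
Proof. by rewrite /bil dagK. Qed.

(** [ip_inj] separates left arguments; the star carries this over to right arguments. *)
Lemma bil_central_inj y y' :
  (forall x, central x -> bil x y = bil x y') -> y = y'.
Proof.
move=> yy'; rewrite -[y]dagK -[y']dagK; congr dag.
apply: (@ip_inj _ _ H) => e; rewrite !dagK -[LHS]ip_star -[RHS]ip_star.
congr star; rewrite !ip_bil; move: {e}(e^†).
apply: centred_ind => [|||c a cc]; first exact: Omega_centred.
- by rewrite !(additive_map0 (bilDl _)).
- by move=> x x' hx hx'; rewrite !bilDl hx hx'.
- by rewrite -cc !bil_lact yy'.
Qed.

Lemma sigmaD : additive_map sg.
Proof. by have [[]] := @sigma_canP _ _ H. Qed.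

Lemma sigma0 : sg 0 = 0.
Proof. exact: additive_map0 sigmaD. Qed.

Lemma sigmaB t u : sg (t - u) = sg t - sg u.
Proof. exact: additive_mapB sigmaD t u. Qed.

Lemma sigma_lact a t : sg (a *: t) = a *: sg t.
Proof. by have [[_ sl _] _ _] := @sigma_canP _ _ H. Qed.

Lemma sigma_ract t a : sg (t ⋅ a) = sg t ⋅ a.
Proof. by have [[_ _ sr] _ _] := @sigma_canP _ _ H. Qed.

Lemma sigma_tens x y : central x \/ central y -> sg (x ⊗ y) = y ⊗ x.
Proof. by have [_ _] := @sigma_canP _ _ H; apply. Qed.

Lemma sigma_dag t : sg t^† = (sg t)^†.
Proof.
have [_ [si [siK _ sid]] _] := @sigma_canP _ _ H.
by rewrite -sid -[X in si X]sigmaK siK.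
Qed.

Lemma PsiE t : Psi t *+ 2 = t + sg t.
Proof. exact: cscale_halfK. Qed.

Lemma ip_rightD x : additive_map (@ip_right _ _ H x).
Proof.
apply: tliftD; split=> [y y' z | y z z' | y a z].
- by rewrite ipDr scalerDl.
- by rewrite scalerDr.
- by rewrite ip_ract scalerA.
Qed.

Lemma ip_rightDl t : additive_map ((@ip_right _ _ H)^~ t).
Proof.
move=> x x'; move: t; apply: tens_additive_ext => [| t u | y z].
- exact: ip_rightD.
- by rewrite !ip_rightD addrACA.
- by rewrite !ip_right_tens ipDl scalerDl.
Qed.

Lemma ip_ractl x a y : ip (x ⋅ a) y = star a * ip x y.
Proof. by rewrite -[LHS]ip_star ip_ract starM ip_star. Qed.

Lemma ip_right_ractl x a t : ip_right (x ⋅ a) t = star a *: ip_right x t.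
Proof.
move: t; apply: tens_additive_ext => [| t u | y z].
- exact: ip_rightD.
- by rewrite ip_rightD scalerDr.
- by rewrite !ip_right_tens ip_ractl scalerA.
Qed.

Lemma ip_right_ract x t a : ip_right x (t ⋅ a) = ip_right x t ⋅ a.
Proof.
move: t; apply: tens_additive_ext => [t u | t u | y z].
- by rewrite ractDl ip_rightD.
- by rewrite ip_rightD ractDl.
- by rewrite ract_tens !ip_right_tens lractA.
Qed.

Lemma ip_leftD y : additive_map ((@ip_left _ _ H)^~ y).
Proof.
apply: tliftD; split=> [x x' z | x z z' | x a z].
- by rewrite ipDl ractDr.
- by rewrite dagD ractDl.
- by rewrite dag_lact -ractA ip_ractl.
Qed.

Lemma ip_left_ractl t y a : ip_left (t ⋅ a) y = star a *: ip_left t y.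
Proof.
move: t; apply: tens_additive_ext => [t u | t u | u v].
- by rewrite ractDl ip_leftD.
- by rewrite ip_leftD scalerDr.
- by rewrite ract_tens !ip_left_tens dag_ract lractA.
Qed.

Lemma ip_left_ract t y a : ip_left t (y ⋅ a) = ip_left t y ⋅ a.
Proof.
move: t; apply: tens_additive_ext => [t u | t u | u v].
- exact: ip_leftD.
- by rewrite ip_leftD ractDl.
- by rewrite !ip_left_tens ip_ract ractA.
Qed.

Lemma ip_leftDr t : additive_map (@ip_left _ _ H t).
Proof.
move=> y y'; move: t; apply: tens_additive_ext => [| t u | u v].
- exact: ip_leftD.
- by rewrite !ip_leftD addrACA.
- by rewrite !ip_left_tens ipDr ractDr.
Qed.

Lemma alphaD w : additive_map ((@alpha _ _ H)^~ w).
Proof.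
apply: tliftD; split=> [t t' v | t v v' | t a v].
- by rewrite ractDl.
- by rewrite dagD ipDl ractDr.
- by rewrite ip_left_linear ractA.
Qed.

Lemma alphaDr T : additive_map (@alpha _ _ H T).
Proof.
move=> w w'; move: T; apply: tens_additive_ext => [| T U | t v].
- exact: alphaD.
- by rewrite !alphaD addrACA.
- by rewrite !alpha_tens ipDr ractDr.
Qed.

Lemma alpha_ract T w a : alpha T (w ⋅ a) = alpha T w ⋅ a.
Proof.
move: T; apply: tens_additive_ext => [| T U | t v].
- exact: alphaD.
- by rewrite alphaD ractDl.
- by rewrite !alpha_tens ip_ract ractA.
Qed.

Lemma dag_tens x y : (x ⊗ y)^† = y^† ⊗ x^†.
Proof. exact: dag2_tens. Qed.

Definition contract x t : H := ip_right x^† t.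

Lemma contract_tens x y z : contract x (y ⊗ z) = bil x y *: z.
Proof. exact: ip_right_tens. Qed.

Lemma contractD x : additive_map (contract x).
Proof. exact: ip_rightD. Qed.

Lemma contract_ract x t a : contract x (t ⋅ a) = contract x t ⋅ a.
Proof. exact: ip_right_ract. Qed.

Lemma contract_lact x t a : central x -> contract x (a *: t) = a *: contract x t.
Proof.
move=> xc; move: t; apply: tens_additive_ext => [t u | t u | y z].
- by rewrite scalerDr contractD.
- by rewrite contractD scalerDr.
- by rewrite lact_tens !contract_tens bil_central_lact // scalerA.
Qed.

Lemma contract_central x t : central x -> central t -> central (contract x t).
Proof. by move=> xc tc a; rewrite -contract_lact // tc contract_ract. Qed.

Definition pair2 x y t : A := bil y (contract x t).

Lemma pair2_tens x y z w : central y ->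
  pair2 x y (z ⊗ w) = bil x z * bil y w.
Proof. by move=> yc; rewrite /pair2 contract_tens bil_central_lact. Qed.

Lemma pair2D x y : additive_map (pair2 x y).
Proof. by move=> t u; rewrite /pair2 contractD bilDr. Qed.

Lemma pair2_ract x y t a : pair2 x y (t ⋅ a) = pair2 x y t * a.
Proof. by rewrite /pair2 contract_ract bil_ract. Qed.

Lemma pair2_lact x y t a : central x -> central y ->
  pair2 x y (a *: t) = a * pair2 x y t.
Proof. by move=> xc yc; rewrite /pair2 contract_lact // bil_central_lact. Qed.

Lemma pair2_central x y t : central x -> central y -> central t ->
  central_elt (pair2 x y t).
Proof. by move=> xc yc tc a; rewrite -pair2_lact // tc pair2_ract. Qed.

Lemma pair2_sigma x y t : central x -> central y ->
  pair2 x y (sg t) = pair2 y x t.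
Proof.
move=> xc yc; move: t; apply: tens_central_ext; first exact: Omega_centred.
- by move=> t u; rewrite sigmaD pair2D.
- exact: pair2D.
move=> c z cc; rewrite sigma_tens; last by left.
by rewrite !pair2_tens // bil_central.
Qed.

Lemma pair2_Psi x y t : central x -> central y ->
  pair2 x y (Psi t) *+ 2 = pair2 x y t + pair2 y x t.
Proof.
move=> xc yc; rewrite -(additive_mapMn (pair2D x y)) PsiE pair2D.
by rewrite pair2_sigma.
Qed.

Lemma pair2_dag x y t : central x -> central y ->
  pair2 x^† y^† t^† = star (pair2 y x t).
Proof.
move=> xc yc; move: t; apply: tens_additive_ext => [t u | t u | z w].
- by rewrite dagD pair2D.
- by rewrite pair2D starD.
- rewrite dag_tens !pair2_tens //; last exact: central_dag.
  rewrite starM !star_bil; congr (_ * _); apply: bil_sym; left; exact: central_dag.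
Qed.

(** The first leg of [t^†] comes from the second leg of [t], which [sigma] brings to the front. *)
Lemma contract_dag x t : central x ->
  (contract x^† t^†)^† = contract x (sg t).
Proof.
move=> xc; move: t; apply: tens_central_ext; first exact: Omega_centred.
- by move=> t u; rewrite !(dagD, contractD).
- by move=> t u; rewrite sigmaD contractD.
move=> c z cc; rewrite dag_tens contract_tens sigma_tens; last by left.
rewrite contract_tens dag_lact star_bil !dagK cc.
by rewrite bil_sym //; right.
Qed.

Lemma pair2_inj t u :
  (forall x y, central x -> central y -> pair2 x y t = pair2 x y u) -> t = u.
Proof.
have [I [c [e ce]]] := frame_exists H.
(* A two-tensor is recovered from its contractions, and these are one-forms, separated by central
   forms. *)
have tE v : v = \sum_i c i ⊗ ip_right (e i) v.
  move: v; apply: tens_additive_ext => [// | v v' | y z].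
    by rewrite -big_split /=; apply: eq_bigr => i _; rewrite ip_rightD tensDr.
  rewrite {1}[y]ce (additive_map_sum (tens_additivel z)).
  by apply: eq_bigr => i _; rewrite ip_right_tens tens_bal.
move=> tu; suff itu x : ip_right x t = ip_right x u.
  by rewrite [t]tE [u]tE; apply: eq_bigr => i _; rewrite itu.
move: x; apply: centred_ind => [|||x a xc]; first exact: Omega_centred.
- by rewrite !(additive_map0 (ip_rightDl _)).
- by move=> x x' hx hx'; rewrite !ip_rightDl hx hx'.
- rewrite !ip_right_ractl; congr (_ *: _); apply: bil_central_inj => y yc.
  have /tu -/(_ y yc) := central_dag xc.
  by rewrite /pair2 /contract dagK.
Qed.

End Pairings.

(** * The exterior derivative and its Leibniz rules *)

Section Differential.
Context {R : realType} {A : starAlgType R}.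
Variable H : centredHermitianCalculus A.
Implicit Types (x y z w : H) (a : A) (t u : tensor H H).

Local Notation T2 := (tensor H H).
Local Notation d := (@diff _ _ (fods H)).
Local Notation sg := (@sigma _ _ H).

Lemma diffD : additive_map d.
Proof. by move=> a b; rewrite -{1}(cmul1 a) diff_linear /cscale cmul1 scale1r. Qed.

Lemma diff1 : d 1 = 0.
Proof.
have := @diff_leibniz _ _ H 1 1; rewrite mulr1 ract1 scale1r => /eqP.
by rewrite -subr_eq0 opprD addNKr oppr_eq0 => /eqP.
Qed.

Lemma diff_scalar (k : R[i]) : d (k ∙ 1) = 0.
Proof.
have := @diff_linear _ _ H k 1 0.
by rewrite !(addr0, additive_map0 diffD) diff1 /cscale scaler0.
Qed.

(** Differentiate $az=za$; the terms $(da)z$ and $z\,da$ cancel because [z] acts equally on both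
    sides of a centred bimodule. *)
Lemma diff_central (z : A) : central_elt z -> central (d z).
Proof.
move=> zc a; have := congr1 d (zc a); rewrite !diff_leibniz.
rewrite (central_elt_act _ (@Omega_centred _ _ H) zc) [RHS]addrC.
by move/addrI.
Qed.

(* Twice the exterior derivative, to avoid the factor 1/2 of 1 - Ψ. *)
Definition ddiff w : T2 := d_Psi w *+ 2.

Lemma ddiffE (s : seq (A * A)) :
  ddiff (\sum_(p <- s) p.1 *: d p.2) =
  \sum_(p <- s) d p.1 ⊗ d p.2 - sg (\sum_(p <- s) d p.1 ⊗ d p.2).
Proof.
rewrite /ddiff d_PsiE mulrnBl PsiE; zmodule.
Qed.

Lemma ddiffD : additive_map ddiff.
Proof.
move=> x y; have [s ->] := diff_span x; have [s' ->] := diff_span y.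
rewrite !ddiffE; have := ddiffE (s ++ s'); rewrite !big_cat /= => ->.
by rewrite sigmaD opprD addrACA.
Qed.

Lemma ddiff_elt a b : ddiff (a *: d b) = d a ⊗ d b - sg (d a ⊗ d b).
Proof. by have := ddiffE [:: (a, b)]; rewrite /= !big_seq1. Qed.

Lemma diff_ind (P : H -> Prop) : P 0 -> (forall x y, P x -> P y -> P (x + y)) ->
  (forall a b, P (a *: d b)) -> forall w, P w.
Proof.
move=> P0 PD Pd w; have [s ->] := diff_span w.
by elim: s => [|p s IH]; rewrite ?big_nil // big_cons; exact: PD.
Qed.

Lemma ddiff_sigma w : sg (ddiff w) = - ddiff w.
Proof.
move: w; apply: diff_ind => [|x y hx hy|a b].
- by rewrite (additive_map0 ddiffD) sigma0 oppr0.
- rewrite ddiffD sigmaD hx hy; zmodule.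
- by rewrite ddiff_elt sigmaB sigmaK opprB.
Qed.

Lemma ddiff_ract w a :
  ddiff (w ⋅ a) = ddiff w ⋅ a - (w ⊗ d a - sg (w ⊗ d a)).
Proof.
move: w; apply: diff_ind => [|x y hx hy|b c].
- by rewrite ract0l (additive_map0 ddiffD) tens0l sigma0 ract0l !subr0.
- rewrite ractDl !ddiffD hx hy tensDl sigmaD (ractDl (ddiff x)); zmodule.
have -> : (b *: d c) ⋅ a = b *: d (c * a) - (b * c) *: d a.
  by rewrite diff_leibniz scalerDr lractA scalerA addrK.
rewrite (additive_mapB ddiffD) !ddiff_elt !diff_leibniz ractBl !tensDr !tensDl.
rewrite !sigmaD !tens_bal -(sigma_ract (d b ⊗ d c)) !ract_tens; zmodule.
Qed.

Lemma ddiff_lact w a :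
  ddiff (a *: w) = a *: ddiff w + (d a ⊗ w - sg (d a ⊗ w)).
Proof.
move: w; apply: diff_ind => [|x y hx hy|b c].
- by rewrite scaler0 (additive_map0 ddiffD) tens0r sigma0 scaler0 subr0 addr0.
- rewrite scalerDr !ddiffD hx hy tensDr sigmaD (scalerDr _ (ddiff x)); zmodule.
rewrite scalerA !ddiff_elt diff_leibniz tensDl sigmaD scalerBr -sigma_lact.
rewrite lact_tens tens_bal; zmodule.
Qed.

(** Compare the two Leibniz rules on $aw=wa$: [sigma] flips the correction terms, so they agree. *)
Lemma ddiff_central w : central w -> central (ddiff w).
Proof.
move=> wc a; have := ddiff_ract w a; rewrite -wc ddiff_lact.
rewrite [sg (d a ⊗ w)]sigma_tens; last by right.
rewrite sigma_tens; last by left.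
by move=> h; apply: (@addIr _ (d a ⊗ w - w ⊗ d a)); rewrite h; zmodule.
Qed.

Lemma ddiff_dag w : ddiff w^† = (ddiff w)^†.
Proof.
move: w; apply: diff_ind => [|x y hx hy|a b].
- by rewrite !(additive_map0 ddiffD, additive_map0 (@dag_additive _ _ _)).
- by rewrite dagD !ddiffD dagD hx hy.
(* The exact summand carries the coefficient 1 so that [ddiff_elt] applies; it vanishes because
   $d1=0$. *)
have -> : (a *: d b)^† = star b *: d (star a) - 1 *: d (star b * star a).
  rewrite dag_lact diff_leibniz scale1r opprD addrCA subrr addr0.
  by rewrite diff_star ractNl opprK.
rewrite (additive_mapB ddiffD) !ddiff_elt diff1.
rewrite tens0l sigma0.
rewrite !subr0 (additive_mapB (@dag_additive _ _ _)) -sigma_dag dag_tens !diff_star.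
by rewrite tensNl tensNr opprK.
Qed.

End Differential.

(** * Koszul's formula and its representation by two-tensors *)

Section Koszul.
Context {R : realType} {A : starAlgType R}.
Variable H : centredHermitianCalculus A.
Implicit Types (c x y z w : H) (a : A) (t u : tensor H H).

Local Notation d := (@diff _ _ (fods H)).

(* Koszul's formula for twice [pair2 x y (nabla w)], with [x], [y] central.    *)
Definition koszul x y w : A :=
  bil y (d (bil x w)) + bil x (d (bil y w)) - bil (d (bil x y)) w
  - bil (contract y (ddiff x) + contract x (ddiff y)) w - pair2 x y (ddiff w).

Lemma koszulD x y : additive_map (koszul x y).
Proof.
by move=> w w'; rewrite /koszul !(bilDr, diffD, ddiffD, pair2D); zmodule.
Qed.

(** The first two terms of [koszul] produce [d a] paired with [y] and with [x]; the correction from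
    [ddiff (w ⋅ a)] doubles the former and cancels the latter. *)
Lemma koszul_ract x y w a : central x -> central y ->
  koszul x y (w ⋅ a) = koszul x y w * a + (bil x w * bil y (d a)) *+ 2.
Proof.
move=> xc yc; rewrite /koszul ddiff_ract !bil_ract !diff_leibniz !bilDr !bil_ract.
rewrite !(bil_central_lact _ _ xc) !(bil_central_lact _ _ yc).
rewrite !(additive_mapB (pair2D _ _)) pair2_ract pair2_sigma // !pair2_tens //.
by rewrite !mulrBl !mulrDl; zmodule.
Qed.

(* The part of [koszul x y c] symmetric in [x] and [y], rewritten so as to be  *)
(* right linear in [y].                                                       *)
Definition koszul_sym c x y : A :=
  bil (d (bil c x)) y + bil x (d (bil c y)) - bil c (d (bil x y))
  + bil (contract c (ddiff x)) y + pair2 c x (ddiff y).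

Lemma koszul_symD c x : additive_map (koszul_sym c x).
Proof.
by move=> w w'; rewrite /koszul_sym !(bilDr, diffD, ddiffD, pair2D); zmodule.
Qed.

(** The derivatives of [a] from the metric terms cancel those from [ddiff (y ⋅ a)]. Here [y] is
    arbitrary, since [ip_surj] asks for a functional on all of $\Omega$. *)
Lemma koszul_sym_ract c x y a : central c -> central x ->
  koszul_sym c x (y ⋅ a) = koszul_sym c x y * a.
Proof.
move=> cc xc; rewrite /koszul_sym ddiff_ract !bil_ract !diff_leibniz !bilDr !bil_ract.
rewrite !(bil_central_lact _ _ xc) !(bil_central_lact _ _ cc).
rewrite !(additive_mapB (pair2D _ _)) pair2_ract pair2_sigma // !pair2_tens //.
by rewrite !mulrDl mulNr; zmodule.
Qed.

Lemma bil_contract_ddiff c x y : central c -> central x -> central y ->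
  bil (contract c (ddiff x)) y = pair2 c y (ddiff x).
Proof. by move=> cc xc yc; rewrite /pair2 bil_sym //; right. Qed.

Lemma koszul_symC c x y : central c -> central x -> central y ->
  koszul_sym c x y = koszul_sym c y x.
Proof.
move=> cc xc yc; rewrite /koszul_sym !bil_contract_ddiff //.
rewrite (@bil_sym _ _ _ x y); last by left.
rewrite (@bil_sym _ _ _ (d _) y); last by right.
rewrite (@bil_sym _ _ _ (d _) x); last by right.
zmodule.
Qed.

Lemma pair2_ddiff_swap c x y : central c -> central x ->
  pair2 c x (ddiff y) = - pair2 x c (ddiff y).
Proof.
move=> cc xc; rewrite -pair2_sigma // ddiff_sigma.
by rewrite (additive_mapN (pair2D _ _)).
Qed.

(** The antisymmetric part is already the pairing with [- ddiff c], so only [koszul_sym] remains to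
    be represented. *)
Lemma koszulE c x y : central c -> central x -> central y ->
  koszul x y c = koszul_sym c x y - pair2 x y (ddiff c).
Proof.
move=> cc xc yc; rewrite /koszul /koszul_sym bilDl !bil_contract_ddiff //.
rewrite [pair2 y c _]pair2_ddiff_swap // [pair2 x c _]pair2_ddiff_swap //.
rewrite (@bil_sym _ _ _ x c); last by right.
rewrite (@bil_sym _ _ _ y c); last by right.
rewrite (@bil_sym _ _ _ (d _) y); last by right.
rewrite (@bil_sym _ _ _ (d (bil x y)) c); last by right.
zmodule.
Qed.

Lemma koszul_sym_central c x y : central c -> central x -> central y ->
  central_elt (koszul_sym c x y).
Proof.
move=> cc xc yc; rewrite /koszul_sym bil_contract_ddiff //.
have dc z w : central z -> central w -> central (d (bil z w)).
  by move=> zc wc; apply/diff_central/bil_central.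
do !apply: central_eltD; rewrite -?mulNr; try apply: central_eltN;
  by [apply: bil_central => //; exact: dc
     | apply: pair2_central => //; exact: ddiff_central].
Qed.

(** For central [x], non-degeneracy represents [koszul_sym c x] by a one-form [K x]. Symmetry makes
    [K] extend right linearly to all [x]; centrality of the values makes it left linear too. Such a
    map is contraction with a two-tensor. *)
Lemma koszul_sym_represented c : central c ->
  exists t, forall x y, central x -> central y ->
    pair2 x y t = koszul_sym c x y.
Proof.
move=> cc.
have kappa x : exists k, forall y, central y -> bil y k = koszul_sym c y x.
  move: x; apply: centred_ind => [|||x a xc]; first exact: Omega_centred.
  - exists 0 => y yc; rewrite (additive_map0 (bilDr _)).
    by rewrite (additive_map0 (koszul_symD _ _)).
  - move=> x x' [k hk] [k' hk']; exists (k + k') => y yc.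
    by rewrite bilDr koszul_symD hk ?hk'.
  have [k hk] := @ip_surj _ _ H (koszul_sym c x) (koszul_symD c x)
    (fun y b => koszul_sym_ract y b cc xc).
  exists (k ⋅ a) => y yc; rewrite bil_ract koszul_sym_ract // koszul_symC //.
  by rewrite bil_sym; [rewrite -hk | left].
pose K x := projT1 (cid (kappa x)).
have KP x y : central y -> bil y (K x) = koszul_sym c y x.
  by rewrite /K; case: cid => k /= hk; exact: hk.
have KD : additive_map K.
  move=> x x'; apply: bil_central_inj => y yc.
  by rewrite bilDr !KP // koszul_symD.
have Kr x a : K (x ⋅ a) = K x ⋅ a.
  apply: bil_central_inj => y yc.
  by rewrite bil_ract !KP // koszul_sym_ract.
have Kc x : central x -> central (K x).
  move=> xc a; apply: bil_central_inj => y yc.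
  by rewrite bil_ract bil_central_lact // !KP // koszul_sym_central.
have Kl a x : K (a *: x) = a *: K x.
  move: x; apply: centred_ind => [|||x b xc]; first exact: Omega_centred.
  - by rewrite scaler0 !(additive_map0 KD) scaler0.
  - by move=> x x' hx hx'; rewrite scalerDr !KD hx hx' scalerDr.
  - by rewrite -lractA xc -ractA !Kr -lractA Kc // ractA.
have [I [f [e fe]]] := frame_exists H.
(* The dagger of the frame expansion of [x^†] writes [x] as the sum of the [bil x (e i) *: (f i)^†],
   to which [K] is applied. *)
exists (\sum_i e i ⊗ K (f i)^†) => x y xc yc.
rewrite /pair2 (additive_map_sum (@contractD _ _ _ _)).
have -> : \sum_i contract x (e i ⊗ K (f i)^†) = K x.
  rewrite -[x in RHS]dagK [x^† in RHS]fe (additive_map_sum (@dag_additive _ _ _)).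
  rewrite (additive_map_sum KD); apply: eq_bigr => i _.
  by rewrite contract_tens dag_ract Kl ip_star.
by rewrite KP // koszul_symC.
Qed.

Lemma koszul_represented w :
  exists t, forall x y, central x -> central y ->
    pair2 x y t *+ 2 = koszul x y w.
Proof.
move: w; apply: centred_ind => [|||c a cc]; first exact: Omega_centred.
- exists 0 => x y _ _; rewrite (additive_map0 (pair2D _ _)) mul0rn.
  by rewrite (additive_map0 (koszulD _ _)).
- move=> w w' [t ht] [t' ht']; exists (t + t') => x y xc yc.
  by rewrite pair2D koszulD mulrnDl ht ?ht'.
have [t ht] := koszul_sym_represented cc.
(* [koszulE] dictates the value at [c], and the Leibniz rule the rest. *)
exists (cscale 2^-1 (t - ddiff c) ⋅ a + c ⊗ d a) => x y xc yc.
rewrite pair2D pair2_ract pair2_tens // mulrnDl koszul_ract // koszulE //.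
congr (_ + _); rewrite -mulrnAl -(additive_mapMn (pair2D x y)) cscale_halfK.
by rewrite (additive_mapB (pair2D x y)) ht.
Qed.

End Koszul.

(** * Uniqueness and existence of the connection *)

Section LeviCivita.
Context {R : realType} {A : starAlgType R}.
Variable H : centredHermitianCalculus A.
Implicit Types (c x y z w : H) (a : A) (t u : tensor H H).
Implicit Type nabla : H -> tensor H H.

Local Notation T2 := (tensor H H).
Local Notation d := (@diff _ _ (fods H)).
Local Notation sg := (@sigma _ _ H).

Lemma right_connectionD nabla :
  right_connection nabla -> additive_map nabla.
Proof.
move=> [nD _] x y; rewrite -[x in LHS](scale1r x) -[in LHS](cmul1 1) nD.
by rewrite /cscale cmul1 scale1r.
Qed.

Lemma right_connection_eq nabla nabla' :
  right_connection nabla -> right_connection nabla' ->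
  (forall c, central c -> nabla c = nabla' c) -> nabla =1 nabla'.
Proof.
move=> nr nr' nn'; apply: centred_ind => [|||c a cc]; first exact: Omega_centred.
- by rewrite !(additive_map0 (right_connectionD _)).
- by move=> x y hx hy; rewrite !(right_connectionD _) ?hx ?hy.
- by rewrite (proj2 nr) (proj2 nr') nn'.
Qed.

Lemma bil_ip_left x y t : central x -> central y ->
  bil y (ip_left t x) = pair2 y x t^†.
Proof.
move=> xc yc; move: t; apply: tens_additive_ext => [t u | t u | u v].
- by rewrite ip_leftD bilDr.
- by rewrite dagD pair2D.
- rewrite ip_left_tens bil_ract dag_tens pair2_tens // ip_bil.
  by congr (_ * _); apply: bil_sym; right.
Qed.

(** This turns the left-hand term of the Hermitian condition into a pairing with [nabla w]
    itself. *)
Lemma sigma_dagger_pair2 nabla x y w : sigma_dagger_connection nabla ->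
  central x -> central y -> bil y (ip_left (nabla w^†) x) = - pair2 x y (nabla w).
Proof.
move=> ns xc yc; rewrite bil_ip_left //.
rewrite -[(nabla _)^†]opprK -ns (additive_mapN (pair2D _ _)).
by rewrite pair2_sigma.
Qed.

Lemma hermitian_pair2 nabla c x y :
  sigma_dagger_connection nabla -> hermitian_connection nabla ->
  central x -> central y ->
  pair2 x y (nabla c) + pair2 c y (nabla x) = bil y (d (bil c x)).
Proof.
move=> ns nh xc yc; rewrite /bil -/(bil _ _) -nh bilDr.
by rewrite (additive_mapN (bilDr _)) sigma_dagger_pair2 // opprK.
Qed.

(** The Leibniz terms cancel, so the defect of the Hermitian condition is right linear in [x] and
    conjugate linear in [w]; central arguments decide. *)
Lemma hermitian_of_pair2 nabla :
  right_connection nabla -> sigma_dagger_connection nabla ->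
  (forall c x y, central c -> central x -> central y ->
    pair2 x y (nabla c) + pair2 c y (nabla x) = bil y (d (bil c x))) ->
  hermitian_connection nabla.
Proof.
move=> nr ns npair w x; have nD := right_connectionD nr; move: x.
apply: centred_ind => [|||x a xc]; first exact: Omega_centred.
- rewrite (additive_map0 (ip_leftDr _)) (additive_map0 nD).
  rewrite (additive_map0 (@ip_rightD _ _ _ _)) oppr0 addr0.
  by rewrite (additive_map0 (f := ip w) (ipDr w)) (additive_map0 (@diffD _ _ _)).
- move=> x x' hx hx'; rewrite ip_leftDr nD ip_rightD ipDr diffD -hx -hx'.
  zmodule.
suff {a} hx : - ip_left (nabla w) x + ip_right w (nabla x) = d (ip w x).
  rewrite ip_left_ract (proj2 nr) ip_rightD ip_right_ract ip_right_tens ip_ract.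
  by rewrite diff_leibniz -hx ractDl ractNl addrA.
move: w; apply: centred_ind => [|||c a cc]; first exact: Omega_centred.
- rewrite (additive_map0 nD) (additive_map0 (ip_leftD _)).
  rewrite (additive_map0 (ip_rightDl _)) oppr0 addr0.
  rewrite (additive_map0 (f := fun u : H => ip u x)) ?(additive_map0 (@diffD _ _ _)) //.
  by move=> u u'; exact: ipDl.
- move=> w w' hw hw'; rewrite nD ip_leftD ip_rightDl ipDl diffD -hw -hw'.
  zmodule.
suff {a} hc : - ip_left (nabla c) x + ip_right c (nabla x) = d (ip c x).
  rewrite (proj2 nr) ip_leftD ip_left_ractl ip_left_tens ip_right_ractl.
  by rewrite ip_ractl diff_leibniz -hc diff_star ractNl scalerDr scalerN; zmodule.
apply: bil_central_inj => y yc; rewrite bilDr (additive_mapN (bilDr _)).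
rewrite -[c]dagK sigma_dagger_pair2 // opprK.
exact: npair (central_dag cc) xc yc.
Qed.

Lemma torsion_free_pair2 nabla x y w : torsion_free nabla ->
  central x -> central y ->
  pair2 x y (nabla w) - pair2 y x (nabla w) = - pair2 x y (ddiff w).
Proof.
move=> nt xc yc; have /eqP := congr1 (fun t => t *+ 2) (nt w).
rewrite mul0rn mulrnDl mulrnBl PsiE -/(ddiff w) addr_eq0 => /eqP h.
rewrite -(additive_mapN (pair2D x y)) -[- ddiff w]h (additive_mapB (pair2D _ _)).
by rewrite (additive_mapMn (pair2D _ _)) pair2D pair2_sigma //; zmodule.
Qed.

Lemma levi_civita_unique nabla nabla' :
  levi_civita nabla -> levi_civita nabla' -> nabla =1 nabla'.
Proof.
move=> [nr nh nt ns] [nr' nh' nt' ns'].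
apply: right_connection_eq => // c cc; apply: pair2_inj.
pose e x y w := pair2 x y (nabla w) - pair2 x y (nabla' w).
have esym x y w : central x -> central y -> e x y w = e y x w.
  move=> xc yc; rewrite /e.
  have := torsion_free_pair2 w nt xc yc.
  rewrite -(torsion_free_pair2 w nt' xc yc) => /eqP.
  rewrite subr_eq => /eqP ->; zmodule.
have eanti x y w : central x -> central y -> central w -> e x y w = - e w y x.
  move=> xc yc wc; rewrite /e.
  have := hermitian_pair2 w ns nh xc yc.
  rewrite -(hermitian_pair2 w ns' nh' xc yc) => /eqP.
  rewrite -subr_eq0 => /eqP h; apply/eqP; rewrite -subr_eq0 -h; apply/eqP.
  zmodule.
move=> x y xc yc; apply/eqP; rewrite -subr_eq0 -/(e x y c); apply/eqP.
apply: (@mulr2n_inj_alg R); rewrite mul0rn.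
(* The two transpositions alternate three times: $((13)(12))^3=1$ restores the arguments with sign
   $(-1)^3$. *)
have h : e x y c = - e x y c.
  by rewrite {1}eanti // esym // eanti // esym // eanti // esym // opprK.
by rewrite mulr2n {1}h addNr.
Qed.

Definition koszul_connection w : T2 := projT1 (cid (koszul_represented w)).

Lemma koszul_connection_pair2 x y w : central x -> central y ->
  pair2 x y (koszul_connection w) *+ 2 = koszul x y w.
Proof. by rewrite /koszul_connection; case: cid => t /= ht; exact: ht. Qed.

Lemma koszul_connection_eq w t :
  (forall x y, central x -> central y -> pair2 x y t *+ 2 = koszul x y w) ->
  koszul_connection w = t.
Proof.
move=> ht; apply: pair2_inj => x y xc yc; apply: (@mulr2n_inj_alg R).
by rewrite koszul_connection_pair2 // ht.
Qed.

Lemma koszul_connection_right : right_connection koszul_connection.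
Proof.
have kr w a : koszul_connection (w ⋅ a) = koszul_connection w ⋅ a + w ⊗ d a.
  apply: koszul_connection_eq => x y xc yc.
  rewrite pair2D pair2_ract pair2_tens // koszul_ract // mulrnDl.
  by rewrite -koszul_connection_pair2 // mulrnAl.
have kD : additive_map koszul_connection.
  move=> w w'; apply: koszul_connection_eq => x y xc yc.
  by rewrite pair2D koszulD mulrnDl !koszul_connection_pair2.
split=> // k w w'; rewrite kD; congr (_ + _).
by rewrite /cscale -!ract_scalar kr diff_scalar tens0r addr0.
Qed.

Lemma koszul_connection_torsion_free : torsion_free koszul_connection.
Proof.
move=> w; apply: mulr2n_inj_lmod; rewrite mul0rn; apply: pair2_inj => x y xc yc.
rewrite mulrnDl mulrnBl PsiE -/(ddiff w) (additive_map0 (pair2D _ _)).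
apply: (@mulr2n_inj_alg R); rewrite mul0rn.
set t := koszul_connection w.
have -> : t *+ 2 - (t + sg t) + ddiff w = t - sg t + ddiff w by zmodule.
rewrite (pair2D x y (t - sg t)) (additive_mapB (pair2D x y)) pair2_sigma //.
rewrite mulrnDl mulrnBl.
rewrite !koszul_connection_pair2 // /koszul.
rewrite (@bil_sym _ _ _ y x); last by left.
rewrite (pair2_ddiff_swap w yc xc) addrC (addrC (contract y _)); zmodule.
Qed.

Lemma koszul_dag x y w : central x -> central y ->
  koszul x^† y^† w^† = - star (koszul x y w).
Proof.
move=> xc yc; have xc' := central_dag xc; have yc' := central_dag yc.
have bd (u v : H) : central u -> central v ->
    bil u^† (d (bil v^† w^†)) = - star (bil u (d (bil v w))).
  move=> uc vc; rewrite bil_sym; last by left; exact: central_dag.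
  rewrite -[bil v^† _]starK star_bil !dagK diff_star (additive_mapN (bilDl _)).
  by rewrite star_bil (@bil_sym _ _ _ w v) //; right.
have bz (u v : H) : central u -> central v ->
    bil (d (bil u^† v^†)) w^† = - star (bil (d (bil u v)) w).
  move=> uc vc; rewrite -[bil u^† _]starK star_bil !dagK diff_star.
  rewrite (additive_mapN (bilDl _)) -star_bil (@bil_sym _ _ _ v u); last by left.
  by rewrite bil_sym //; right; exact/diff_central/bil_central.
have bc (u v : H) : central u -> central v ->
    bil (contract u^† (ddiff v^†)) w^† = - star (bil (contract u (ddiff v)) w).
  move=> uc vc; rewrite ddiff_dag -[contract _ _]dagK contract_dag // ddiff_sigma.
  rewrite (additive_mapN (@contractD _ _ _ _)) -star_bil (additive_mapN (bilDr _)).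
  rewrite (additive_mapN star_additive) bil_sym //.
  by right; apply: contract_central => //; exact: ddiff_central.
rewrite /koszul !bilDl !bd // bz // !bc // ddiff_dag pair2_dag //.
rewrite (pair2_ddiff_swap _ yc xc) !(starD, additive_mapN star_additive); zmodule.
Qed.

Lemma koszul_connection_sigma_dagger : sigma_dagger_connection koszul_connection.
Proof.
move=> w; apply: pair2_inj => x y xc yc; apply: (@mulr2n_inj_alg R).
rewrite (additive_mapN (pair2D _ _)) pair2_sigma // koszul_connection_pair2 //.
have -> : pair2 x y (koszul_connection w^†)^† =
          star (pair2 y^† x^† (koszul_connection w^†)).
  by rewrite -[x in LHS]dagK -[y in LHS]dagK pair2_dag //; exact: central_dag.
rewrite mulNrn -(additive_mapMn star_additive).
rewrite koszul_connection_pair2 ?koszul_dag ?(additive_mapN star_additive) //.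
- by rewrite starK opprK.
- exact: central_dag.
- exact: central_dag.
Qed.

Lemma koszul_connection_hermitian : hermitian_connection koszul_connection.
Proof.
have ks := koszul_connection_sigma_dagger.
apply: hermitian_of_pair2 => //; first exact: koszul_connection_right.
move=> c x y cc xc yc; apply: (@mulr2n_inj_alg R).
rewrite mulrnDl !koszul_connection_pair2 // !koszulE //.
rewrite /koszul_sym !bil_contract_ddiff // (pair2_ddiff_swap y cc xc).
rewrite (@bil_sym _ _ _ x c); last by left.
rewrite (@bil_sym _ _ _ (d _) y); last by right.
zmodule.
Qed.

Lemma koszul_connection_levi_civita : levi_civita koszul_connection.
Proof.
split.
- exact: koszul_connection_right.
- exact: koszul_connection_hermitian.
- exact: koszul_connection_torsion_free.
- exact: koszul_connection_sigma_dagger.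
Qed.

End LeviCivita.

(** * Additivity of the associators *)

Section TensorMapsAdditive.
Context {R : realType} {A : starAlgType R}.
Variables X Y Z : bimodType A.

Lemma tassocD : additive_map (@tassoc _ _ X Y Z).
Proof.
have bal (w : Z) : balanced (fun (x : X) (y : Y) => x ⊗ (y ⊗ w)).
  split=> [x x' y|x y y'|x a y]; first exact: tensDl.
    by rewrite tensDl tensDr.
  by rewrite tens_bal lact_tens.
apply: tliftD; split=> [t t' w|t w w'|t a w]; first exact: tliftD.
  by rewrite -big_split /=; apply: eq_bigr => p _; rewrite !tensDr.
move: t; apply: tens_additive_ext => [t u|t u|x y].
- by rewrite ractDl; exact: tliftD.
- exact: tliftD.
- by rewrite ract_tens !tlift_tens // tens_bal.
Qed.

Lemma tassoc_invD : additive_map (@tassoc_inv _ _ X Y Z).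
Proof.
have bal (x : X) : balanced (fun (y : Y) (z : Z) => (x ⊗ y) ⊗ z).
  split=> [y y' z|y z z'|y a z]; last by rewrite -tens_bal ract_tens.
    by rewrite tensDr tensDl.
  exact: tensDr.
apply: tliftD; split=> [x x' t|x t t'|x a t].
- by rewrite -big_split /=; apply: eq_bigr => p _; rewrite !tensDl.
- exact: tliftD.
move: t; apply: tens_additive_ext => [t u|t u|y z].
- exact: tliftD.
- by rewrite scalerDr; exact: tliftD.
- by rewrite lact_tens !tlift_tens // tens_bal.
Qed.

Lemma bimodule_map_id : bimodule_map (id : X -> X).
Proof. by []. Qed.

End TensorMapsAdditive.

(** * The explicit formula in a central frame *)

Section CentralFrame.
Context {R : realType} {A : starAlgType R}.
Variable H : centredHermitianCalculus A.
Implicit Types (c x y z w : H) (a : A) (t u : tensor H H).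

Local Notation T2 := (tensor H H).
Local Notation T3 := (tensor (tensor H H) H).
Local Notation d := (@diff _ _ (fods H)).
Implicit Type T : T3.

Lemma PprojD : additive_map (@Pproj _ _ H).
Proof.
by apply/tliftD/tmap_balanced; [exact: Psi_bimodule_map | exact: bimodule_map_id].
Qed.

Lemma Pproj_tensl t z : Pproj (t ⊗ z) = Psi t ⊗ z.
Proof. by rewrite /Pproj tmap_tens //; exact: Psi_bimodule_map. Qed.

Lemma QprojD : additive_map (@Qproj _ _ H).
Proof.
move=> T U; rewrite /Qproj tassocD -tassoc_invD; congr tassoc_inv.
by apply/tliftD/tmap_balanced; [exact: bimodule_map_id | exact: Psi_bimodule_map].
Qed.

Definition pair3 x y w T : A := pair2 x y (alpha T w).

Lemma pair3D x y w : additive_map (pair3 x y w).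
Proof. by move=> T U; rewrite /pair3 alphaD pair2D. Qed.

Lemma pair3_tens x y w t z : pair3 x y w (t ⊗ z) = pair2 x y t * bil z w.
Proof. by rewrite /pair3 alpha_tens pair2_ract. Qed.

Lemma pair3_Pproj x y w T : central x -> central y ->
  pair3 x y w (Pproj T) *+ 2 = pair3 x y w T + pair3 y x w T.
Proof.
move=> xc yc; move: T; apply: tens_additive_ext => [T U|T U|t z].
- by rewrite PprojD pair3D mulrnDl.
- by rewrite !pair3D addrACA.
- by rewrite Pproj_tensl !pair3_tens -mulrnAl pair2_Psi // mulrDl.
Qed.

Lemma pair3_tassoc_inv x y w z t : central y -> central w ->
  pair3 x y w (tassoc_inv (z ⊗ t)) = bil x z * pair2 y w t.
Proof.
move=> yc wc; move: t; apply: tens_additive_ext => [t u|t u|u v].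
- by rewrite tensDr tassoc_invD pair3D.
- by rewrite pair2D mulrDr.
- rewrite tassoc_inv_tens pair3_tens !pair2_tens // mulrA.
  by congr (_ * _); apply: bil_sym; right.
Qed.

Lemma pair3_Qproj x y w T : central y -> central w ->
  pair3 x y w (Qproj T) *+ 2 = pair3 x y w T + pair3 x w y T.
Proof.
move=> yc wc; move: T; apply: tens_additive_ext => [T U|T U|t z].
- by rewrite QprojD pair3D mulrnDl.
- by rewrite !pair3D addrACA.
move: t; apply: tens_additive_ext => [t u|t u|u v].
- by rewrite tensDl QprojD pair3D mulrnDl.
- by rewrite tensDl !pair3D addrACA.
rewrite Qproj_tens -tassoc_inv_tens !pair3_tassoc_inv // -mulrnAr.
by rewrite pair2_Psi // mulrDr.
Qed.

Variable s : {fset H * H}.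
Hypothesis sframe : central_frame s.

Let s_central p : p \in s -> central p.1 /\ central p.2.
Proof. by case: sframe => sc _ _ _; exact: sc. Qed.

Lemma frame_sum_dag (V : zmodType) (F : H -> H -> V) :
  \sum_(p <- s) F p.1 p.2 = \sum_(p <- s) F p.1^† p.2^†.
Proof.
case: sframe => _ sd _ _; rewrite -{1}sd big_imfset //= => p q _ _.
by case: p q => [x y] [x' y'] /= [/(can_inj (@dagK _ _ _)) -> /(can_inj (@dagK _ _ _)) ->].
Qed.

(** The Grassmann connection of the frame, averaged over the two roles of its families. *)
Definition grassmann w : T2 :=
  cscale 2^-1 (\sum_(p <- s) (p.1 ⊗ d (ip p.2 w) + p.2 ⊗ d (ip p.1 w))).

Lemma pair2_grassmann x y w : central y ->
  pair2 x y (grassmann w) *+ 2 =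
  \sum_(p <- s) (bil x p.1 * bil y (d (ip p.2 w)) +
                 bil x p.2 * bil y (d (ip p.1 w))).
Proof.
move=> yc; rewrite -(additive_mapMn (pair2D x y)) cscale_halfK.
rewrite (additive_map_sum (pair2D x y)); apply: eq_bigr => p _.
by rewrite pair2D !pair2_tens.
Qed.

(** Expand [x] inside [bil w x] by both frame identities. Where [d] hits the coefficients of [x],
    the terms form the summand of [grassmann x]; the others form that of [grassmann w], once its
    frame is replaced by the daggered one. *)
Lemma grassmann_metric x y w : central x -> central y -> central w ->
  pair2 x y (grassmann w) + pair2 w y (grassmann x) = bil y (d (bil w x)).
Proof.
move=> xc yc wc; apply: (@mulr2n_inj_alg R); rewrite mulrnDl !pair2_grassmann //.
rewrite (frame_sum_dag (fun e f => bil x e * bil y (d (ip f w)) +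
  bil x f * bil y (d (ip e w)))) -big_split /=.
have [_ _ fr1 fr2] := sframe.
have dE (e f : H * H -> H) : (forall p, p \in s -> central (e p) /\ central (f p)) ->
    x = \sum_(p <- s) e p ⋅ ip (f p) x -> bil y (d (bil w x)) =
    \sum_(p <- s) (ip (f p) x * bil y (d (bil w (e p))) +
      bil w (e p) * bil y (d (ip (f p) x))).
  move=> efc {1}->; rewrite (additive_map_sum (bilDr w)).
  rewrite (additive_map_sum (@diffD _ _ H)) (additive_map_sum (bilDr y)).
  apply: eq_big_seq => p /efc [ec fc].
  rewrite bil_ract diff_leibniz bilDr bil_ract bil_central_lact //; congr (_ + _).
  by apply/esym/bil_central => //; exact/diff_central/bil_central.
have sc' p : p \in s -> central p.2 /\ central p.1 by move=> /s_central [].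
rewrite mulr2n {1}(dE fst snd s_central (fr1 x)) (dE snd fst sc' (fr2 x)).
rewrite -big_split /=; apply: eq_big_seq => p /s_central [ec fc].
have ipE e f : central e -> ip e^† f = bil f e by move=> ?; apply: bil_sym; left.
rewrite !ipE // (@bil_sym _ _ _ x) -?ip_bil; last by left.
rewrite (@bil_sym _ _ _ x) -?ip_bil; last by left.
zmodule.
Qed.

Variable nabla : H -> T2.
Hypothesis nabla_lc : levi_civita nabla.

Let nabla_right : right_connection nabla.
Proof. by case: nabla_lc. Qed.

(** The difference of two right connections is right linear; this three-tensor represents
    [nabla - grassmann]. *)
Definition christoffel : T3 :=
  cscale 2^-1 (\sum_(p <- s) (nabla p.1 ⊗ p.2^† + nabla p.2 ⊗ p.1^†)).

Lemma alpha_christoffel w : alpha christoffel w = nabla w - grassmann w.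
Proof.
apply: mulr2n_inj_lmod; rewrite mulrnBl cscale_halfK.
have alD := @alphaD _ _ H w; rewrite -(additive_mapMn alD) cscale_halfK.
rewrite (additive_map_sum alD); have [_ _ fr1 fr2] := sframe.
have nE (e f : H * H -> H) : w = \sum_(p <- s) e p ⋅ ip (f p) w ->
    nabla w = \sum_(p <- s) (nabla (e p) ⋅ ip (f p) w + e p ⊗ d (ip (f p) w)).
  move=> {1}->; rewrite (additive_map_sum (right_connectionD nabla_right)).
  by apply: eq_bigr => p _; rewrite (proj2 nabla_right).
rewrite mulr2n {1}(nE fst snd (fr1 w)) (nE snd fst (fr2 w)) -big_split -sumrB.
apply: eq_bigr => p _ /=; rewrite alphaD !alpha_tens !dagK; zmodule.
Qed.

Lemma W_tensor_christoffel : W_tensor s = Pproj christoffel - christoffel.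
Proof.
apply: mulr2n_inj_lmod; rewrite mulrnBl -(additive_mapMn PprojD) !cscale_halfK.
rewrite (additive_map_sum PprojD) -sumrB; apply: eq_bigr => p _.
have dE z : d_Psi z = Psi (nabla z) - nabla z.
  case: nabla_lc => _ _ /(_ z)/eqP; rewrite addrC addr_eq0 => /eqP ->.
  by rewrite opprB.
rewrite PprojD !Pproj_tensl !dE !tensDl !tensNl; zmodule.
Qed.

Lemma christoffel_anti x y w : central x -> central y -> central w ->
  pair3 x y w christoffel = - pair3 w y x christoffel.
Proof.
case: nabla_lc => nr nh nt ns xc yc wc.
rewrite /pair3 !alpha_christoffel !(additive_mapB (pair2D _ _)).
have := hermitian_pair2 w ns nh xc yc.
rewrite -grassmann_metric // => /eqP; rewrite -subr_eq0 => /eqP h.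
apply/eqP; rewrite -subr_eq0 -h; apply/eqP; zmodule.
Qed.

(** Let $s_1,s_2$ swap the first two and the last two arguments of [pair3], and let $V$ be
    [christoffel]. On pairings $2P=1+s_1$, $2Q=1+s_2$, $2W=(s_1-1)V$ and $s_1s_2s_1V=-V$, whence
    $s_2s_1V=-s_1V$ and $s_1s_2V=-s_2V$. Expanding, $(1+(1+s_1)(1+s_2))(s_1-1)V=-2V$. *)
Lemma levi_civita_formula w :
  nabla w = grassmann w - alpha (W_tensor s + Pproj (Qproj (W_tensor s)) *+ 4) w.
Proof.
suff : alpha christoffel w =
       alpha (- (W_tensor s + Pproj (Qproj (W_tensor s)) *+ 4)) w.
  rewrite alpha_christoffel (additive_mapN (@alphaD _ _ H w)) => /eqP.
  by rewrite subr_eq addrC => /eqP.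
set U := - _.
move: w; apply: centred_ind => [|||w a wc]; first exact: Omega_centred.
- by rewrite !(additive_map0 (alphaDr _)).
- by move=> w w' hw hw'; rewrite !alphaDr hw hw'.
rewrite !alpha_ract; congr (_ ⋅ _); apply: pair2_inj => x y xc yc.
rewrite -!/(pair3 _ _ _ _) /U (additive_mapN (pair3D _ _ _)) pair3D.
rewrite (mulrnA _ 2 2) !(additive_mapMn (pair3D _ _ _)) pair3_Pproj // mulrnDl.
rewrite !pair3_Qproj //; apply: (@mulr2n_inj_alg R); rewrite mulNrn !mulrnDl.
have WE x' y' w' : central x' -> central y' -> pair3 x' y' w' (W_tensor s) *+ 2 =
    pair3 y' x' w' christoffel - pair3 x' y' w' christoffel.
  move=> xc' yc'; rewrite W_tensor_christoffel (additive_mapB (pair3D _ _ _)).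
  by rewrite mulrnBl pair3_Pproj //; zmodule.
rewrite !WE // (christoffel_anti wc xc yc) (christoffel_anti wc yc xc).
rewrite (christoffel_anti yc wc xc); zmodule.
Qed.

End CentralFrame.

Theorem theorem4p24 (R : realType) (A : starAlgType R)
    (H : centredHermitianCalculus A) :
  (exists! nabla : H -> tensor H H, levi_civita nabla) /\
  (forall (nabla : H -> tensor H H), levi_civita nabla ->
   forall s : {fset H * H}, central_frame s ->
   forall w : H,
     nabla w =
       cscale 2^-1 (\sum_(p <- s) (p.1 ⊗ diff H (ip p.2 w) + p.2 ⊗ diff H (ip p.1 w)))
       - alpha (W_tensor s + Pproj (Qproj (W_tensor s)) *+ 4) w).
Proof.
split=> [|nabla nlc s sframe w]; last exact: levi_civita_formula.
have lc := koszul_connection_levi_civita H.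
exists (@koszul_connection _ _ H); split=> // nabla nlc.
by apply/funext => w; exact: levi_civita_unique.
Qed.
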